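(* Let $f,g$ be $\mathcal C^2$ concave functions satisfying assumption (A1) (recalled in the context), and assume $\delta=0$. Consider any constant initial data $u(0,x)=u_0\in\,]0,\alpha[\,$, $x\in[0,L]$, with $\theta\equiv1$ at the initial time, so that the flux is $f$ at every point. Let $u$ be the corresponding random solution (described in the context) of $$u_t+\Big[\theta(u_x)f(u)+(1-\theta(u_x))g(u)\Big]_x=0,\qquad u(t,0)=u(t,L).$$ Then with probability one $$\lim_{t\to+\infty}\bigl\|u(t,\cdot)-u_0\bigr\|_{L^\infty}=0.$$
   Context: Assumption (A1): $g(u)=\frac{\beta}{2}u(\alpha-u)$ for constants $\alpha,\beta>0$; $f$ is a $\mathcal C^2$ concave function with $f(0)=g(0)=f(\alpha)=g(\alpha)=0$, $f'(0)=g'(0)$, $f'(\alpha)=g'(\alpha)$, $f(u)>g(u)$ for all $u\in\,]0,\alpha[\,$; and for some $\beta^*>0$ one has $f''(u)\le-\beta^*$ and $g''(u)\le-\beta^*$ for all $u\in\,]0,\alpha[\,$. $L>0$ is fixed; all functions of $x$ are extended by $L$-periodicity. Random data: $0<t_1<t_2<\cdots$ is a Poisson arrival process with rate $\lambda>0$, i.e. with $t_0=0$ the increments $t_j-t_{j-1}$ are i.i.d. with $\mathrm{Prob}\{t_j-t_{j-1}>s\}=e^{-\lambda s}$ for $s\ge0$; the $X_j$ are independent random variables, uniformly distributed on $[0,L]$ (and independent of the times). Random solution when $\delta=0$: at each time $u(t,\cdot)$ is piecewise $\mathcal C^1$, $L$-periodic, with finitely many upward jumps. On each open interval between consecutive jumps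 either $u(t,x)=u_0$ and the flux is $f$ (i.e. $\theta=1$), or $u_x(t,x)<0$ and the flux is $g$ (i.e. $\theta=0$). Jumps travel with the Rankine-Hugoniot speed determined by the fluxes and the states on the two sides; two jumps which meet merge into a single one. On $[0,t_1]$ one has $u=u_0$. At each time $t_j$: if $X_j$ lies in an open interval where the flux is $f$, then a new $N$-shaped spike is inserted at $X_j$, namely, for $t>t_j$ close to $t_j$ there are two jump curves $y'(t)<y''(t)$, both converging to $X_j$ as $t\to t_j+$, such that $u(t,x)=\frac\alpha2-\frac{x-X_j}{\beta(t-t_j)}$ for $y'(t)<x<y''(t)$, while near $X_j$ and outside $[y'(t),y''(t)]$ the solution is unchanged. Otherwise the solution is prolonged without adding any new spike. No other new jumps are created. *)

(* Defs.v *)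
From HB Require Import structures.
From mathcomp Require Import all_boot all_order all_algebra.
From mathcomp Require Import all_classical all_reals all_analysis.

Set Implicit Arguments.
Unset Strict Implicit.
Unset Printing Implicit Defensive.
Import Order.TTheory GRing.Theory Num.Theory.
Import numFieldNormedType.Exports.
Local Open Scope ring_scope.
Local Open Scope classical_set_scope.

Definition C2 {R : realType} (f : R -> R) : Prop :=
  [/\ forall x : R, derivable f x 1, forall x : R, derivable (derive1 f) x 1
    & continuous (derive1n 2 f)].

Definition concave {R : realType} (f : R -> R) : Prop :=
  @convex_function R R^o setT (fun x => - f x).

Record flux_assumption {R : realType} (f g : R -> R) (alpha beta : R) : Prop :=
  FluxAssumption {
    fa_alpha : 0 < alpha;
    fa_beta : 0 < beta;
    fa_g : forall w, g w = beta / 2 * w * (alpha - w);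
    fa_C2f : C2 f;
    fa_C2g : C2 g;
    fa_concf : concave f;
    fa_concg : concave g;
    fa_0 : f 0 = 0 /\ g 0 = 0;
    fa_1 : f alpha = 0 /\ g alpha = 0;
    fa_d0 : derive1 f 0 = derive1 g 0;
    fa_d1 : derive1 f alpha = derive1 g alpha;
    fa_gt : forall w : R, 0 < w < alpha -> g w < f w;
    fa_strict : exists2 bstar : R, 0 < bstar &
      forall w : R, 0 < w < alpha ->
        derive1n 2 f w <= - bstar /\ derive1n 2 g w <= - bstar
  }.

(** ** Deterministic description of the solution for given arrival data *)

(* [C1_at v t x]: near (t, x) both partial derivatives of v exist, and they are
   continuous at (t, x). *)
Definition C1_at {R : realType} (v : R -> R -> R) (t x : R) : Prop :=
  [/\ \forall p \near ((t, x) : R * R),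
        derivable (v ^~ p.2) p.1 1 /\ derivable (v p.1) p.2 1,
      {for ((t, x) : R * R),
         continuous (fun p : R * R => derive1 (v ^~ p.2) p.1)}
    & {for ((t, x) : R * R),
         continuous (fun p : R * R => derive1 (v p.1) p.2)}].

Definition flux {R : realType} (f g : R -> R) (th : bool) : R -> R :=
  if th then f else g.

(* Structure of the solution over a time interval [a, b] in which no jumps are
   created or merge, except possibly at the two end points.

   The jumps in x are the values y i t for i : int. The family is invariant
   under translation by L: there are n > 0 jumps per period, and y (i + n) is
   the translate of y i. The i-th piece is the region y i t < x < y (i + 1) t,
   with flux f if th i and flux g otherwise. The curves may touch at time a (a
   spike is inserted) and at time b (jumps meet).

   On the i-th piece u coincides with v i, which is of class C1 up to the
   boundary of the piece; thus v (i - 1) t (y i t) and v i t (y i t) are the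
   left and right states of the jump y i. The points where y i t = y (i + 1) t
   are excluded: an N-shaped spike is not continuous at its apex. *)
Record front_slab {R : realType} (f g : R -> R) (L u0 : R)
    (u : R -> R -> R) (theta : R -> R -> bool) (a b : R)
    (y : int -> R -> R) (v : int -> R -> R -> R) (th : int -> bool) : Prop :=
  FrontSlab {
    fs_period : exists2 n : nat, (0 < n)%N &
      forall (i : int) (t : R), a <= t <= b -> y (i + n%:Z) t = y i t + L;
    fs_cont : forall i : int, {within `[a, b], continuous (y i)};
    fs_order : forall (i : int) (t : R), a < t < b -> y i t < y (i + 1) t;
    fs_C1 : forall (i : int) (t x : R), a <= t <= b -> y i t < y (i + 1) t ->
      y i t <= x <= y (i + 1) t -> C1_at (v i) t x;
    fs_state : forall (i : int) (t x : R),
      a <= t <= b -> y i t < x < y (i + 1) t ->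
      u t x = v i t x /\ theta t x = th i;
    fs_f : forall (i : int) (t x : R), a <= t <= b -> y i t < x < y (i + 1) t ->
      th i -> v i t x = u0;
    fs_g : forall (i : int) (t x : R),
      a <= t <= b -> y i t < x < y (i + 1) t -> ~~ th i ->
      derive1 (v i t) x < 0 /\
      derive1 (v i ^~ x) t + derive1 (fun z => g (v i t z)) x = 0;
    fs_upward : forall (i : int) (t : R), a < t < b ->
      v (i - 1) t (y i t) < v i t (y i t);
    fs_RankineHugoniot : forall (i : int) (t : R), a < t < b ->
      derivable (y i) t 1 /\
      derive1 (y i) t * (v i t (y i t) - v (i - 1) t (y i t)) =
        flux f g (th i) (v i t (y i t))
        - flux f g (th (i - 1)) (v (i - 1) t (y i t));
    (* As usual for conservation laws, solutions are bounded. This matters only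
       near the apex of a spike: there the other conditions still allow jumps
       y with |y t - X| of the order of sqrt (t - a). *)
    fs_bounded : exists M : R, forall (i : int) (t x : R), a <= t <= b ->
      y i t < x < y (i + 1) t -> `|u t x| <= M
  }.

(* How the jumps y starting at time a are related to the set P of jump points
   just before. Ins is the set of points where a spike is inserted at time a:
   exactly two jumps start from each of them, and exactly one from each
   point of P. In particular jumps that have met at time a have merged. *)
Record front_start {R : realType} (alpha beta : R) (u : R -> R -> R)
    (a : R) (P Ins : set R) (y : int -> R -> R) : Prop :=
  FrontStart {
    st_range : range (y ^~ a) = P `|` Ins;
    st_two : forall p, Ins p -> exists i : int, y i a = p /\ y (i + 1) a = p;
    st_single : forall i : int, y i a < y (i + 1) a \/ Ins (y i a);
    st_le : forall i : int, y i a <= y (i + 1) a;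
    st_no_three : forall i : int, y i a < y (i + 2) a;
    st_spike : forall i : int, y i a = y (i + 1) a ->
      \forall t \near a^'+, forall x, y i t < x < y (i + 1) t ->
        u t x = alpha / 2 - (x - y i a) / (beta * (t - a))
  }.

(* Points of spike insertion at time s, for arrivals T j (j >= 1) at positions
   X j, when P is the set of jump points at time s. *)
Definition insertions {R : realType} (L : R) (T X : nat -> R)
    (theta : R -> R -> bool) (s : R) (P : set R) : set R :=
  [set x | exists j (m : int),
     [/\ (0 < j)%N, T j = s, ~ P (X j), theta s (X j) & x = X j + m%:~R * L]].

(* The solution with data u0, theta = 1, for arrival times T j and positions
   X j, j >= 1. The increasing sequence s, with s 0 = T 1, contains all the
   times at which jumps are created or meet; it may contain other times. The
   values of u and theta at the jumps themselves are irrelevant. *)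
Definition spike_solution {R : realType} (f g : R -> R) (alpha beta L u0 : R)
    (T X : nat -> R) (u : R -> R -> R) (theta : R -> R -> bool) : Prop :=
  [/\ forall (t x : R), 0 <= t ->
        u t (x + L) = u t x /\ theta t (x + L) = theta t x,
      forall (t x : R), 0 <= t <= T 1%N -> u t x = u0 /\ theta t x = true
    & exists (s : nat -> R) (y : nat -> int -> R -> R)
        (v : nat -> int -> R -> R -> R) (th : nat -> int -> bool),
      let P k := if k is k'.+1 then range (y k' ^~ (s k)) else set0 in
      [/\ s 0%N = T 1%N,
          forall k, s k < s k.+1,
          s k @[k --> \oo] --> +oo,
          forall j, (0 < j)%N -> exists k, s k = T j
        & forall k,
            front_slab f g L u0 u theta (s k) (s k.+1) (y k) (v k) (th k) /\
            front_start alpha beta u (s k) (P k)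
              (insertions L T X theta (s k) (P k)) (y k)]].

(** ** Random data *)

Definition mutually_independent {d : measure_display} {Omega : measurableType d}
    {R : realType} (P : probability Omega R) (I : eqType)
    (Z : I -> Omega -> R) : Prop :=
  forall (r : seq I) (B : I -> set R), uniq r ->
    (forall i, measurable (B i)) ->
    P (\bigcap_(i in [set` r]) (Z i @^-1` B i)) =
      (\prod_(i <- r) P (Z i @^-1` B i))%E.

(* [inl j] is the increment between arrivals j and j + 1; [inr j] is the
   position of arrival j + 1. X 0 plays no role. *)
Definition arrival_family {R : realType} {Omega : Type}
    (T X : nat -> Omega -> R) (i : nat + nat) : Omega -> R :=
  match i with
  | inl j => fun w => T j.+1 w - T j w
  | inr j => X j.+1
  end.

(* The law of the increments gives T j < T j.+1 almost surely (s = 0). *)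
Record random_arrivals {d : measure_display} {Omega : measurableType d}
    {R : realType} (P : probability Omega R) (lambda L : R) (L_gt0 : 0 < L)
    (T X : nat -> {RV P >-> R}) : Prop :=
  RandomArrivals {
    ra_T0 : forall w, T 0%N w = 0;
    ra_incr : forall j (s : R), 0 <= s ->
      P [set w | s < T j.+1 w - T j w] = (expR (- (lambda * s)))%:E;
    ra_unif : forall j, (0 < j)%N -> forall A : set R, measurable A ->
      distribution P (X j) A = uniform_prob L_gt0 A;
    ra_indep : mutually_independent P
      (arrival_family (fun j => T j : Omega -> R) (fun j => X j : Omega -> R))
  }.

(* Main.v *)
Require Import Defs.
From HB Require Import structures.
From mathcomp Require Import all_boot all_order all_algebra.
From mathcomp Require Import all_classical all_reals all_analysis.
From mathcomp Require Import ess_sup_inf zify ring lra.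

Set Implicit Arguments.
Unset Strict Implicit.
Unset Printing Implicit Defensive.
Import Order.TTheory GRing.Theory Num.Theory.
Import numFieldNormedType.Exports.
Local Open Scope ring_scope.
Local Open Scope classical_set_scope.

(* Let c > 0 with f u0 = g u0 + beta c^2 / 2. Where the flux is g, u is constant
   along characteristics, and these, traced backwards, do not leave the region
   through a jump; so u keeps the form alpha/2 - (x - X)/(beta (t - T)) on each
   such piece. The trace of u next to an f-interval is u0 + c or u0 - c, hence
   every f-interval shrinks at the constant speed 2 beta c: after the time
   S = T_1 + L/(2 beta c) no f-interval is left, and no spike can be inserted any
   more. From then on u is a sawtooth, with slopes between -1/(beta (t - S))
   and 0. The primitive of u0 - u, normalized to vanish on the f-intervals, is
   continuous across the jumps by the Rankine-Hugoniot conditions; being also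
   periodic, it forces |u - u0| <= L/(beta (t - S)). Randomness only matters
   through T_1 >= 0. *)

(** The constant c comes from the two lines through (u0, f u0) tangent to the graph of g: since g is
    quadratic, they touch it at u0 - c and u0 + c. A jump between u0 and one of these states is
    therefore sonic, that is, it moves with the characteristic speed of its g-side, so the trace
    there is stationary and no characteristic enters through the jump. The amplitude c is not
    assumed at a new spike. The profile is singular at the apex, and Rankine-Hugoniot only says that
    the potential along each emitted jump is constant; boundedness of u forces this constant to be
    0, which means |u - u0| = c. Equality of potentials is also what survives mergers: it chains
    through all jumps that meet at a point, so a g-piece that becomes a neighbour of an f-interval
    again has the trace u0 + c or u0 - c. Characteristics are never constructed: a maximum principle
    on a moving strip replaces them. *)

(** * Differentiability in one and two variables *)

Lemma is_derive_epsP {R : realType} (h : R -> R) (x dv : R) :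
  is_derive x 1 h dv <->
  forall e, 0 < e -> exists2 d, 0 < d & forall z, `|z - x| < d ->
    `|h z - h x - dv * (z - x)| <= e * `|z - x|.
Proof.
split=> [hd e e0|H].
  have [hx dvE] := hd.
  move: hx => /cvgrPdist_le/(_ _ e0); rewrite -/(derive h x 1) dvE.
  rewrite /= => /nbhs_ballP[d /= d0 H].
  exists d => // z zd.
  have [->|zx] := eqVneq z x; first by rewrite !subrr mulr0 subr0 normr0 mulr0.
  have /= := H (z - x).
  rewrite /ball /= sub0r normrN => /(_ zd); rewrite subr_eq0 => /(_ zx).
  rewrite /GRing.scale /= mulr1 subrK => {}H.
  have zx0 : z - x != 0 by rewrite subr_eq0.
  have -> : h z - h x - dv * (z - x) =
      - (dv - (z - x)^-1 * (h z - h x)) * (z - x) by field.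
  by rewrite normrM normrN ler_wpM2r.
have hd : (fun k => k^-1 *: ((h \o shift x) (k *: 1) - h x)) @ 0^' --> dv.
  apply/cvgrPdist_le => e e0; have [d d0 {}H] := H _ e0.
  apply/nbhs_ballP; exists d => // k /=.
  rewrite /ball /= sub0r normrN => kd k0.
  have /= := H (k + x); rewrite addrK => /(_ kd).
  rewrite /GRing.scale /= mulr1 => {}H.
  have -> : dv - k^-1 * (h (k + x) - h x) =
      - k^-1 * (h (k + x) - h x - dv * k) by field.
  rewrite normrM normrN normfV mulrC ler_pdivrMr ?normr_gt0//.
apply: DeriveDef; first by apply/cvg_ex; exists dv.
exact/cvg_lim.
Qed.

Lemma derivable_is_derive1 {R : realType} (h : R -> R) (x : R) :
  derivable h x 1 -> is_derive x 1 h (derive1 h x).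
Proof. by move=> hx; rewrite derive1E; exact: derivableP. Qed.

Lemma is_derive_derive1 {R : realType} (h : R -> R) (x dv : R) :
  is_derive x 1 h dv -> derive1 h x = dv.
Proof. by move=> [_ <-]; rewrite derive1E. Qed.

Lemma is_derive_within {R : realType} (h dh : R -> R) (a b : R) :
  (forall t, a <= t <= b -> is_derive t 1 h (dh t)) ->
  {within `[a, b], continuous h}.
Proof.
move=> hd; apply: derivable_within_continuous => t; rewrite in_itv => /hd[].
by [].
Qed.

Lemma MVT_dist {R : realType} (h dh : R -> R) (t s : R) :
  (forall c, `|c - t| <= `|s - t| -> is_derive c 1 h (dh c)) ->
  exists2 c, `|c - t| <= `|s - t| & h s - h t = dh c * (s - t).
Proof.
move=> hd; have [ts|st] := leP t s.
  have sub c : t <= c <= s -> `|c - t| <= `|s - t|.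
    by move=> /andP[? ?]; rewrite !ger0_norm ?subr_ge0// lerD2r.
  have [c|c|c] := @MVT_segment _ h dh t s ts.
  - by rewrite in_itv/= => /andP[/ltW ? /ltW ?]; apply/hd/sub/andP.
  - by move: c; apply: is_derive_within => c /sub/hd.
  - by rewrite in_itv/= => /sub; exists c.
have sub c : s <= c <= t -> `|c - t| <= `|s - t|.
  move=> /andP[? ?]; rewrite !ler0_norm ?subr_le0// ?lerN2 ?lerD2r//.
  exact: ltW.
have [c|c|c] := @MVT_segment _ h dh s t (ltW st).
- by rewrite in_itv/= => /andP[/ltW ? /ltW ?]; apply/hd/sub/andP.
- by move: c; apply: is_derive_within => c /sub/hd.
- by rewrite in_itv/= => /sub ? E; exists c => //; lra.
Qed.

(** Total differentiability at (t, x), with explicit partial derivatives so that it can be composed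
    with a jump curve. *)
Definition frechet {R : realType} (E : R -> R -> R) (t x et ex : R) : Prop :=
  forall e, 0 < e -> exists2 d, 0 < d &
    forall s z, `|s - t| < d -> `|z - x| < d ->
      `|E s z - E t x - et * (s - t) - ex * (z - x)| <=
        e * (`|s - t| + `|z - x|).

Lemma near_pair {R : realType} (t x : R) (Q : R -> R -> Prop) :
  (\forall p \near ((t, x) : R * R), Q p.1 p.2) <->
  exists2 d, 0 < d & forall s z, `|s - t| < d -> `|z - x| < d -> Q s z.
Proof.
split=> [/nbhs_ballP[d /= d0 H]|[d d0 H]].
  by exists d => // s z sd zd; apply: (H (s, z)); split; rewrite /ball /= distrC.
apply/nbhs_ballP; exists d => // -[s z] [/= sd zd].
by apply: H; rewrite distrC.
Qed.

Lemma continuous_pairP {R : realType} (E : R -> R -> R) (t x : R) :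
  {for ((t, x) : R * R), continuous (fun p : R * R => E p.1 p.2)} <->
  forall e, 0 < e -> exists2 d, 0 < d &
    forall s z, `|s - t| < d -> `|z - x| < d -> `|E s z - E t x| <= e.
Proof.
split=> [/cvgrPdist_le H e e0|H].
  have /(near_pair t x (fun s z => `|E t x - E s z| <= e))[d d0 {}H] := H _ e0.
  by exists d => // s z sd zd; rewrite distrC H.
apply/cvgrPdist_le => e e0; have [d d0 {}H] := H _ e0.
apply/(near_pair t x (fun s z => `|E t x - E s z| <= e)).
by exists d => // s z sd zd; rewrite distrC H.
Qed.

Lemma frechet_continuous {R : realType} (E : R -> R -> R) (t x et ex : R) :
  frechet E t x et ex ->
  {for ((t, x) : R * R), continuous (fun p : R * R => E p.1 p.2)}.
Proof.
move=> H; apply/continuous_pairP => e e0.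
have [d d0 {}H] := H _ ltr01.
set M := 1 + `|et| + `|ex|.
have M0 : 0 < M by rewrite /M -addrA ltr_wpDr// addr_ge0.
exists (Num.min d (e / (2 * M))).
  by rewrite lt_min d0 divr_gt0// mulr_gt0.
move=> s z; rewrite !lt_min => /andP[sd se] /andP[zd ze]; move: (H s z sd zd).

set A := `|s - t| in sd se *; set B := `|z - x| in zd ze *.
move: se ze; rewrite !ltr_pdivlMr ?mulr_gt0// => se ze {}H.
have -> : E s z - E t x = (E s z - E t x - et * (s - t) - ex * (z - x)) +
   (et * (s - t) + ex * (z - x)) by ring.
apply: (le_trans (ler_normD _ _)); apply: (le_trans (lerD H (ler_normD _ _))).
rewrite !normrM -/A -/B.
have A0 : 0 <= A by rewrite /A.
have B0 : 0 <= B by rewrite /B.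
have et0 := normr_ge0 et; have ex0 := normr_ge0 ex.
have : `|et| * A <= `|et| * A + `|et| * B by rewrite lerDl mulr_ge0.
have : `|ex| * B <= `|ex| * A + `|ex| * B by rewrite lerDr mulr_ge0.
by rewrite /M in se ze; lra.
Qed.

(** The increment is split at (t, z): the mean value theorem in time and continuity of the time
    derivative control the first part, differentiability of [v t] at x the second. *)
Lemma C1_at_frechet {R : realType} (v : R -> R -> R) (t x : R) :
  C1_at v t x -> frechet v t x (derive1 (v ^~ x) t) (derive1 (v t) x).
Proof.
move=> [/(near_pair t x (fun s z => derivable (v ^~ z) s 1 /\ derivable (v s) z 1))].
move=> [d1 d10 H1] /(continuous_pairP (fun s z => derive1 (v ^~ z) s)) H2 _ e e0.
have [d2 d20 {}H2] := H2 _ e0.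
have [||_ dx] := H1 t x; rewrite ?subrr ?normr0//.
have /is_derive_epsP/(_ _ e0)[d3 d30 H3] := derivable_is_derive1 dx.
exists (Num.min d1 (Num.min d2 d3)); first by rewrite !lt_min d10 d20.
move=> s z; rewrite !lt_min => /and3P[s1 s2 s3] /and3P[z1 z2 z3].
have [c ct vc] := @MVT_dist _ (v ^~ z) (derive1 (v ^~ z)) t s (fun c ct =>
  derivable_is_derive1 (proj1 (H1 c z (le_lt_trans ct s1) z1))).
have := H2 c z (le_lt_trans ct s2) z2.
have := H3 _ z3.
have -> : v s z - v t x = (v s z - v t z) + (v t z - v t x) by ring.
rewrite vc => {}H3 {}H2.
set D := derive1 (v ^~ x) t in H2 *.
set X := derive1 (v t) x in H3 *.
set C := derive1 (v ^~ z) c in H2 *.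
have -> : C * (s - t) + (v t z - v t x) - D * (s - t) - X * (z - x) =
  (C - D) * (s - t) + (v t z - v t x - X * (z - x)) by ring.
rewrite [e * _]mulrDr.
apply: (le_trans (ler_normD _ _)); apply: lerD => //.
by rewrite normrM ler_wpM2r.
Qed.

Lemma frechet_chain {R : realType} (E : R -> R -> R) (y : R -> R)
    (t et ex y' : R) :
  frechet E t (y t) et ex -> is_derive t 1 y y' ->
  is_derive t 1 (fun s => E s (y s)) (et + ex * y').
Proof.
move=> HE /is_derive_epsP Hy; apply/is_derive_epsP => e e0.
have [d1 d10 {}H1] := Hy _ ltr01.
(* [K] bounds the difference quotients of [y] at t within distance [d1], which converts errors in y
   into errors in time; each of the two error terms gets half of e. *)
set K := 1 + `|y'|.
have K1 : 1 <= K by rewrite /K lerDl.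
have K0 : 0 < K by exact: lt_le_trans ltr01 K1.
have e2 : 0 < e / (2 * (1 + K)) by rewrite divr_gt0// mulr_gt0// addr_gt0.
have [d2 d20 {}H2] := HE _ e2.
have e3 : 0 < e / (2 * (1 + `|ex|)) by rewrite divr_gt0// mulr_gt0// ltr_wpDr.
have [d3 d30 {}H3] := Hy _ e3.
exists (Num.min (Num.min d1 (d2 / K)) (Num.min d2 d3)).
  by rewrite !lt_min d10 d20 d30 divr_gt0.
move=> s; rewrite !lt_min => /andP[/andP[s1 sK] /andP[s2 s3]].
have yL : `|y s - y t| <= K * `|s - t|.
  have -> : y s - y t = (y s - y t - y' * (s - t)) + y' * (s - t) by ring.
  apply: (le_trans (ler_normD _ _)); rewrite normrM /K mulrDl.
  by rewrite lerD2r H1.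
have yd2 : `|y s - y t| < d2.
  by apply: (le_lt_trans yL); rewrite mulrC -ltr_pdivlMr.
have := H2 _ _ s2 yd2; have := H3 _ s3.
set A := `|s - t| in yL s1 s2 s3 sK *.
set B := y s - y t - y' * (s - t) => HB.
set C := E s (y s) - _ - _ - _ => HC.
have -> : E s (y s) - E t (y t) - (et + ex * y') * (s - t) = C + ex * B.
  by rewrite /C /B; ring.
apply: (le_trans (ler_normD _ _)); rewrite normrM.
have A0 : 0 <= A by rewrite /A.
have HC2 : `|C| <= e / 2 * A.
  apply: (le_trans HC).
  apply: (@le_trans _ _ (e / (2 * (1 + K)) * ((1 + K) * A))).
    apply: ler_wpM2l; first exact: ltW.
    by rewrite [leRHS]mulrDl mul1r lerD2l.
  have -> : e / (2 * (1 + K)) * ((1 + K) * A) = e / 2 * A.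
    by field; rewrite gt_eqF// addr_gt0.
  by [].
have HB2 : `|ex| * `|B| <= e / 2 * A.
  apply: (@le_trans _ _ ((1 + `|ex|) * (e / (2 * (1 + `|ex|)) * A))).
    by apply: ler_pM => //; rewrite lerDr.
  have -> : (1 + `|ex|) * (e / (2 * (1 + `|ex|)) * A) = e / 2 * A.
    by field; rewrite gt_eqF// ltr_wpDr.
  by [].
lra.
Qed.

(** * Signs of derivatives and a maximum principle for transport equations *)

Lemma derive_le0_right {R : realType} (h : R -> R) (x dv r : R) :
  is_derive x 1 h dv -> 0 < r ->
  (forall z, x < z < x + r -> h z <= h x) -> dv <= 0.
Proof.
move=> /is_derive_epsP H r0 hle; rewrite leNgt; apply/negP => dv0.
have [|d d0 {}H] := H (dv / 2); first by rewrite divr_gt0.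
set m := Num.min d r / 2.
have m0 : 0 < m by rewrite divr_gt0// lt_min d0.
have [md mr] : m < d /\ m < r.
  have : m < Num.min d r by rewrite /m ltr_pdivrMr// ltr_pMr ?ltr1n// lt_min d0.
  by rewrite lt_min => /andP.
have := H (x + m); rewrite addrAC subrr add0r gtr0_norm// => /(_ md).
have : h (x + m) <= h x by apply: hle; rewrite ltrDl m0 ltrD2l.
move=> h1; rewrite ler_norml => /andP[h2 _].
have : 0 < dv * m by rewrite mulr_gt0.
lra.
Qed.

Lemma is_derive_reflect {R : realType} (h : R -> R) (x dv : R) :
  is_derive x 1 h dv -> is_derive (- x) 1 (fun z => h (- z)) (- dv).
Proof.
move=> /is_derive_epsP H; apply/is_derive_epsP => e /H[d d0 {}H].
exists d => // z; rewrite opprK => zx.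
have E : `|- z - x| = `|z + x| by rewrite -opprD normrN.
by have := H (- z); rewrite E => /(_ zx); congr (`|_| <= _); ring.
Qed.

Lemma derive_ge0_left {R : realType} (h : R -> R) (x dv r : R) :
  is_derive x 1 h dv -> 0 < r ->
  (forall z, x - r < z < x -> h z <= h x) -> 0 <= dv.
Proof.
move=> /is_derive_reflect H r0 hle; rewrite -oppr_le0.
apply: (derive_le0_right H r0) => z /andP[z1 z2]; rewrite opprK.
by apply: hle; apply/andP; split; lra.
Qed.

Lemma within_itvP {R : realType} (h : R -> R) (a b : R) :
  {within `[a, b], continuous h} -> forall t, a <= t <= b ->
  forall e, 0 < e -> exists2 d, 0 < d & forall s, a <= s <= b ->
    `|s - t| < d -> `|h s - h t| <= e.
Proof.
move=> /subspace_continuousP hc t tab e e0.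
have /cvgrPdist_le/(_ _ e0) := hc t tab.
move=> /nbhs_ballP[d /= d0 H]; exists d => // s sab sd.
by rewrite distrC; apply: (H s) => //=; rewrite /ball /= distrC.
Qed.

Lemma frechet_x {R : realType} (E : R -> R -> R) (t x et ex : R) :
  frechet E t x et ex -> is_derive x 1 (E t) ex.
Proof.
move=> H; apply/is_derive_epsP => e /H[d d0 {}H]; exists d => // z zd.
by have := H t z; rewrite subrr normr0 mulr0 subr0 add0r; exact.
Qed.

(* A maximum of E - e (t - t0) cannot be attained after t0: on a lateral side
   this follows from the derivatives along that side and along x, since the
   transport lines of speed lam do not enter through it. *)
Lemma transport_max {R : realType} (yl yr yl' yr' : R -> R)
    (E et ex lam : R -> R -> R) (t0 t1 : R) :
  {within `[t0, t1], continuous yl} -> {within `[t0, t1], continuous yr} ->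
  (forall t, t0 <= t <= t1 -> yl t < yr t) ->
  (forall t, t0 < t <= t1 -> is_derive t 1 yl (yl' t)) ->
  (forall t, t0 < t <= t1 -> is_derive t 1 yr (yr' t)) ->
  (forall t x, t0 <= t <= t1 -> yl t <= x <= yr t ->
     frechet E t x (et t x) (ex t x)) ->
  (forall t x, t0 < t <= t1 -> yl t <= x <= yr t ->
     et t x + lam t x * ex t x = 0) ->
  (forall t, t0 < t <= t1 -> lam t (yl t) <= yl' t) ->
  (forall t, t0 < t <= t1 -> yr' t <= lam t (yr t)) ->
  (forall x, yl t0 <= x <= yr t0 -> E t0 x <= 0) ->
  forall t x, t0 <= t <= t1 -> yl t <= x <= yr t -> E t x <= 0.
Proof.
move=> cl cr lr dl dr dE pde laxl laxr init ts xs tsI xsI.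
rewrite leNgt; apply/negP => Epos.
(* The rescaled coordinate s in [0, 1] turns the moving strip into the fixed compact rectangle
   [B]. *)
pose x_ t s := yl t + s * (yr t - yl t).
have x_in t s : t0 <= t <= t1 -> 0 <= s <= 1 -> yl t <= x_ t s <= yr t.
  move=> /lr; rewrite -subr_gt0 => /ltW lt /andP[s0 s1].
  by rewrite /x_ lerDl mulr_ge0//= -lerBrDl ler_piMl.
have x_out t x : t0 <= t <= t1 -> yl t <= x <= yr t ->
    exists2 s, 0 <= s <= 1 & x = x_ t s.
  move=> /lr; rewrite -subr_gt0 => lt /andP[x1 x2].
  exists ((x - yl t) / (yr t - yl t)).
    by rewrite ler_pdivrMr// mul1r lerD2r x2 divr_ge0 ?subr_ge0// -subr_ge0 ltW.
  by rewrite /x_; field; rewrite gt_eqF.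
have t01 : t0 <= t1 by case/andP: tsI => /le_trans; apply.
(* Small enough for E - e (t - t0) to stay positive at (ts, xs); the 1 keeps the denominator
   positive when t0 = t1. *)
pose e := E ts xs / (2 * (t1 - t0 + 1)).
have tt0 : 0 < 2 * (t1 - t0 + 1) by lra.
have e0 : 0 < e by rewrite /e divr_gt0.
pose Psi (p : R * R) := E p.1 (x_ p.1 p.2) - e * (p.1 - t0).
pose B : set (R * R) := `[t0, t1] `*` `[0, 1].
have Bin t s : B (t, s) <-> (t0 <= t <= t1 /\ 0 <= s <= 1).
  by rewrite /B /setX /= !in_itv.
have cB : compact B by apply: compact_setX; exact: segment_compact.
have cPsi : {within B, continuous Psi}.
  apply/subspace_continuousP => -[t s] /Bin[tI sI].
  apply/cvgrPdist_le => eps eps0; rewrite near_withinE.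
  have /frechet_continuous/continuous_pairP cE := dE t _ tI (x_in t s tI sI).
  have eps2 : 0 < eps / 2 by rewrite divr_gt0.
  have [d1 d10 H1] := cE _ eps2.
  pose M := yr t - yl t.
  have M0 : 0 < M by rewrite subr_gt0 lr.
  have d4 : 0 < d1 / 8 by rewrite divr_gt0.
  have [d2 d20 H2] := within_itvP cl tI d4.
  have [d3 d30 H3] := within_itvP cr tI d4.
  apply/(near_pair t s (fun t' s' => B (t', s') ->
    `|Psi (t, s) - Psi (t', s')| <= eps)).
  exists (Num.min (Num.min d1 (Num.min d2 d3))
       (Num.min (d1 / (8 * M)) (eps / (2 * e)))).
    by rewrite !lt_min d10 d20 d30 !divr_gt0// mulr_gt0.
  move=> t' s'; rewrite !lt_min => /andP[/and3P[ta tb tc] /andP[td te]].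
  move=> /andP[/and3P[sa sb sc] /andP[sd se]] /Bin[t'I s'I].
  have {}H2 := H2 _ t'I tb; have {}H3 := H3 _ t'I tc.
  have xd : `|x_ t' s' - x_ t s| < d1.
    have -> : x_ t' s' - x_ t s = (1 - s') * (yl t' - yl t) +
        (s' * (yr t' - yr t) + (s' - s) * M).
      by rewrite /x_ /M; ring.
    apply: (le_lt_trans (ler_normD _ _)).
    apply: (le_lt_trans (lerD (lexx _) (ler_normD _ _))); rewrite !normrM.
    case/andP: s'I => s'0 s'1.
    rewrite (ger0_norm s'0) (@ger0_norm _ (1 - s')) ?subr_ge0// (gtr0_norm M0).
    have : (1 - s') * `|yl t' - yl t| <= 1 * (d1 / 8).
      by apply: ler_pM; rewrite ?subr_ge0// gerBl.
    have : s' * `|yr t' - yr t| <= 1 * (d1 / 8) by apply: ler_pM.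
    have : `|s' - s| * M <= d1 / 8.
      rewrite -ler_pdivlMr//; apply: (le_trans (ltW sd)).
      by rewrite invfM mulrA.
    lra.
  have := H1 _ _ ta xd; rewrite /Psi /= => HE.
  have -> : E t (x_ t s) - e * (t - t0) - (E t' (x_ t' s') - e * (t' - t0)) =
    - (E t' (x_ t' s') - E t (x_ t s)) + e * (t' - t) by ring.
  apply: (le_trans (ler_normD _ _)); rewrite normrN normrM (gtr0_norm e0).
  have : e * `|t' - t| <= eps / 2.
    rewrite mulrC -ler_pdivlMr//; apply: (le_trans (ltW te)).
    by rewrite invfM mulrA.
  lra.
have [ss ssI xsE] := x_out _ _ tsI xsI.
have B0 : B !=set0 by exists (ts, ss); apply/Bin.
have [[t2 s2] /set_mem B2 mx] := compact_EVT_max B0 cB cPsi.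
have [t2I s2I] := (Bin _ _).1 B2.
have {mx} mx t s : t0 <= t <= t1 -> 0 <= s <= 1 ->
    E t (x_ t s) - e * (t - t0) <= E t2 (x_ t2 s2) - e * (t2 - t0).
  by move=> tI sI; apply: (mx (t, s)); apply/mem_set/Bin.
have m0 : 0 < E t2 (x_ t2 s2) - e * (t2 - t0).
  apply: lt_le_trans (mx _ _ tsI ssI); rewrite -xsE.
  have : e * (ts - t0) <= e * (t1 - t0 + 1).
    by apply: ler_wpM2l; [exact: ltW|lra].
  have -> : e * (t1 - t0 + 1) = E ts xs / 2 by rewrite /e; field; lra.
  lra.
have [t2E|t2N] := eqVneq t2 t0.
  by move: m0; rewrite t2E subrr mulr0 subr0 ltNge init// x_in// lexx.
have t2I' : t0 < t2 <= t1.
  by case/andP: t2I => t02 ->; rewrite andbT lt_neqAle eq_sym t2N.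
have x2I := x_in _ _ t2I s2I.
have dE2 := dE _ _ t2I x2I.
have pde2 := pde _ _ t2I' x2I.
set x2 := x_ t2 s2 in m0 mx dE2 pde2 x2I.
set ET := et t2 x2 in dE2 pde2; set EX := ex t2 x2 in dE2 pde2.
have dx : is_derive t2 1 (x_ ^~ s2) (yl' t2 + s2 * (yr' t2 - yl' t2)).
  have := dl _ t2I'; have := dr _ t2I' => ? ?.
  by apply: is_derive_eq; rewrite /GRing.scale/=; ring.
(* Maximality at t2 along the curve of constant s makes the left derivative of E - e (t - t0)
   nonnegative. *)
have along : e <= ET + EX * (yl' t2 + s2 * (yr' t2 - yl' t2)).
  have := frechet_chain (y := x_ ^~ s2) dE2 dx.
  move=> dEx; have d2 : is_derive t2 1 (fun s => E s (x_ s s2) - e * (s - t0))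
     (ET + EX * (yl' t2 + s2 * (yr' t2 - yl' t2)) - e).
    by apply: is_derive_eq; rewrite /GRing.scale/=; ring.
  rewrite -subr_ge0; apply: (@derive_ge0_left _ _ _ _ (t2 - t0) d2).
    by rewrite subr_gt0; case/andP: t2I'.
  move=> z /andP[z1 z2]; apply: mx => //.
  by case/andP: t2I' => ? ?; apply/andP; split; lra.
have E_le x : yl t2 <= x <= yr t2 -> E t2 x <= E t2 x2.
  by move=> /(x_out _ _ t2I)[s sI ->]; have := mx _ _ t2I sI; lra.
have EX0l : s2 < 1 -> EX <= 0.
  move=> s21; have := lr _ t2I; rewrite -subr_gt0 => lt.
  apply: (@derive_le0_right _ _ _ _ ((1 - s2) * (yr t2 - yl t2)) (frechet_x dE2)).
    by rewrite mulr_gt0// subr_gt0.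
  move=> z /andP[z1 z2]; apply: E_le.
  have -> : yr t2 = x2 + ((1 - s2) * (yr t2 - yl t2)) by rewrite /x2 /x_; ring.
  by case/andP: x2I => ? _; apply/andP; split; lra.
have EX0r : 0 < s2 -> 0 <= EX.
  move=> s21; have := lr _ t2I; rewrite -subr_gt0 => lt.
  apply: (@derive_ge0_left _ _ _ _ (s2 * (yr t2 - yl t2)) (frechet_x dE2)).
    by rewrite mulr_gt0.
  move=> z /andP[z1 z2]; apply: E_le.
  have E1 : x2 - (s2 * (yr t2 - yl t2)) = yl t2 by rewrite /x2 /x_; ring.
  by case/andP: x2I => _ ?; apply/andP; split; lra.
case/andP: s2I => s20 s21.
(* On the left side EX <= 0 and lam <= yl', so ET + EX yl' = EX (yl' - lam) <= 0, against [along].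
   The right side is symmetric; inside, EX = 0 and the equation gives ET = 0. *)
have [s2E|s2N] := eqVneq s2 0.
  have := laxl _ t2I'.
  have x2E : x2 = yl t2 by rewrite /x2 /x_ s2E mul0r addr0.
  rewrite -x2E => lx.
  have := EX0l; rewrite s2E ltr01 => /(_ isT) EX0.
  move: along; rewrite s2E mul0r addr0 => along.
  have : (lam t2 x2 - yl' t2) * EX >= 0 by rewrite mulr_le0// subr_le0.
  nra.
have s2p : 0 < s2 by rewrite lt_neqAle eq_sym s2N.
have [s2E|s2N1] := eqVneq s2 1.
  have := laxr _ t2I'.
  have x2E : x2 = yr t2 by rewrite /x2 /x_ s2E; ring.
  rewrite -x2E => lx.
  have EX0 := EX0r s2p.
  move: along; rewrite s2E mul1r addrC => along.
  have : (lam t2 x2 - yr' t2) * EX >= 0 by rewrite mulr_ge0// subr_ge0.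
  nra.
have s2q : s2 < 1 by rewrite lt_neqAle s2N1.
have EX0 : EX = 0 by apply/eqP; rewrite eq_le EX0l// EX0r.
by move: along pde2; rewrite EX0; lra.
Qed.

Lemma deriv_le0_le {R : realType} (h dh : R -> R) (a b : R) :
  a <= b -> {within `[a, b], continuous h} ->
  (forall t, a < t < b -> is_derive t 1 h (dh t)) ->
  (forall t, a < t < b -> dh t <= 0) -> h b <= h a.
Proof.
move=> ab ch dhE dh0; have [->//|ab'] := eqVneq a b.
have {ab'} ab' : a < b by rewrite lt_neqAle ab'.
have dhI t : t \in `]a, b[%R -> is_derive t 1 h (dh t).
  by rewrite in_itv/= => /dhE.
have [t tI E] := MVT ab' dhI ch.
have := dh0 t; rewrite in_itv/= in tI => /(_ tI) d0.
by rewrite -subr_le0 E mulr_le0_ge0// subr_ge0.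
Qed.

Lemma deriv0_eq {R : realType} (h : R -> R) (a b : R) :
  a <= b -> {within `[a, b], continuous h} ->
  (forall t, a < t < b -> is_derive t 1 h 0) -> h b = h a.
Proof.
move=> ab ch dh; apply/eqP; rewrite eq_le (deriv_le0_le (dh := fun=> 0) ab ch)//=.
rewrite -lerN2; apply: (deriv_le0_le (h := \- h) (dh := fun=> 0) ab) => //.
  by move=> t; apply: continuousN; exact: ch.
by move=> t tI; have := dh t tI => ?; apply: is_derive_eq; rewrite oppr0.
Qed.

(* A wave is [None] where the flux is f and u = u0; it is [Some (X, T)] on the
   centered rarefaction emitted from the point X at time T. *)
Definition wave_state {R : realType} (alpha beta u0 : R)
    (K : option (R * R)) (t x : R) : R :=
  if K is Some k then alpha / 2 - (x - k.1) / (beta * (t - k.2)) else u0.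

(* A primitive in x of u0 - u, normalized to vanish where the flux is f. With
   f u0 = g u0 + beta c^2 / 2, the Rankine-Hugoniot conditions say precisely
   that the difference between the potentials on the two sides of a jump is
   constant in time. *)
Definition wave_pot {R : realType} (alpha beta u0 c : R)
    (K : option (R * R)) (t x : R) : R :=
  if K is Some k then
    (x - k.1 - beta * (alpha / 2 - u0) * (t - k.2)) ^+ 2
      / (2 * beta * (t - k.2)) - beta * c ^+ 2 / 2 * (t - k.2)
  else 0.

(** * A single wave: potential, propagation, trace next to an f-interval *)

Section waves.
Variables (R : realType) (f g : R -> R) (alpha beta u0 c : R).
Hypothesis beta0 : 0 < beta.
Hypothesis c0 : 0 < c.
Hypothesis gE : forall w, g w = beta / 2 * w * (alpha - w).
Hypothesis cE : f u0 = g u0 + beta * c ^+ 2 / 2.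
Local Notation state := (wave_state alpha beta u0).
Local Notation pot := (wave_pot alpha beta u0 c).
Local Notation speed := (beta * (alpha / 2 - u0)).

(** So the potential vanishes exactly where the state differs from u0 by c: the value 0 on the
    f-side of a jump fixes the amplitude on the other side. *)
Lemma wave_pot_state k t x : k.2 < t ->
  pot (Some k) t x =
    beta * (t - k.2) / 2 * ((state (Some k) t x - u0) ^+ 2 - c ^+ 2).
Proof.
move=> kt; rewrite /wave_pot /wave_state; field.
by rewrite subr_eq0 (gt_eqF kt) gt_eqF.
Qed.

(** The partial derivatives of the potential are u0 - u in x and flux minus f u0 in t. For two waves
    along the same jump, the difference of these total derivatives is the defect in the
    Rankine-Hugoniot condition. *)
Lemma is_derive_wave_pot (K : option (R * R)) (t : R) (y : R -> R)
    (y' : R) :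
  (forall k, K = Some k -> k.2 < t) ->
  is_derive t 1 y y' ->
  is_derive t 1 (fun s => pot K s (y s))
   (- (state K t (y t) - u0) * y' +
      flux f g (~~ isSome K) (state K t (y t)) - f u0).
Proof.
case: K => [[X T]|] kt dy; last first.
  rewrite /=; have -> : - (u0 - u0) * y' + f u0 - f u0 = 0 by ring.
  exact: is_derive_cst.
have {}kt : T < t by have := kt _ erefl.
have tT : t - T != 0 by rewrite subr_eq0 gt_eqF.
have b0 : beta != 0 by rewrite gt_eqF.
have dV : is_derive t 1 (fun s => (2 * beta * (s - T))^-1)
   (- (2 * beta * (t - T)) ^- 2 * (2 * beta)).
  have n0 : 2 * beta * (t - T) != 0 by rewrite !mulf_neq0// pnatr_eq0.
  have d1 : is_derive t 1 (fun s => 2 * beta * (s - T)) (2 * beta).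
    by apply: is_derive_eq; rewrite /GRing.scale/=; ring.
  by have := @is_deriveV _ (fun s => 2 * beta * (s - T)) t _ 1 n0 d1; rewrite /GRing.scale/=.
rewrite /wave_pot /=.
apply: is_derive_eq.
rewrite cE !gE /GRing.scale/=; field.
by rewrite tT b0.
Qed.

(** [E] vanishes exactly where v is the rarefaction [k]. Its factor s - k.2 removes any zero-order
    term: [E] is transported with the characteristic speed g'(v) = beta (alpha/2 - v), and the
    maximum principle applies to [E] and to - [E]. *)
Lemma piece_evolution (v : R -> R -> R) (yl yr yl' yr' : R -> R)
    (k : R * R) (t0 t1 : R) :
  k.2 < t0 ->
  {within `[t0, t1], continuous yl} -> {within `[t0, t1], continuous yr} ->
  (forall t, t0 <= t <= t1 -> yl t < yr t) ->
  (forall t, t0 < t <= t1 -> is_derive t 1 yl (yl' t)) ->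
  (forall t, t0 < t <= t1 -> is_derive t 1 yr (yr' t)) ->
  (forall t x, t0 <= t <= t1 -> yl t <= x <= yr t -> C1_at v t x) ->
  (forall t x, t0 < t <= t1 -> yl t <= x <= yr t ->
    derive1 (v ^~ x) t + beta * (alpha / 2 - v t x) * derive1 (v t) x = 0) ->
  (forall t, t0 < t <= t1 -> beta * (alpha / 2 - v t (yl t)) <= yl' t) ->
  (forall t, t0 < t <= t1 -> yr' t <= beta * (alpha / 2 - v t (yr t))) ->
  (forall x, yl t0 <= x <= yr t0 -> v t0 x = state (Some k) t0 x) ->
  forall t x, t0 <= t <= t1 -> yl t <= x <= yr t ->
    v t x = state (Some k) t x.
Proof.
move=> kt0 cl cr lr dl dr C1 pde laxl laxr init t x tI xI.
have b0 : beta != 0 by rewrite gt_eqF.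
pose E s z := (s - k.2) * (v s z - alpha / 2) + (z - k.1) / beta.
pose et s z := v s z - alpha / 2 + (s - k.2) * derive1 (v ^~ z) s.
pose ex s z := (s - k.2) * derive1 (v s) z + beta^-1.
have dE s z : t0 <= s <= t1 -> yl s <= z <= yr s ->
    frechet E s z (et s z) (ex s z).
  move=> sI zI; have Cv := C1 s z sI zI.
  have fv := C1_at_frechet Cv.
  have /continuous_pairP cv := frechet_continuous fv.
  move=> e e0.
  have sk : 0 < s - k.2.
    by rewrite subr_gt0; case/andP: sI => /(lt_le_trans kt0)->.
  have e2 : 0 < e / 2 by rewrite divr_gt0.
  have e3 : 0 < e / (2 * (s - k.2)) by rewrite divr_gt0// mulr_gt0.
  have [d1 d10 H1] := fv _ e3; have [d2 d20 H2] := cv _ e2.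
  exists (Num.min d1 d2); first by rewrite lt_min d10.
  move=> s' z'; rewrite !lt_min => /andP[s1 s2] /andP[z1 z2].
  have {H1} := H1 _ _ s1 z1; have {H2} := H2 _ _ s2 z2.
  set A := v s' z' - v s z => HA.
  set B := _ - derive1 (v s) z * (z' - z) => HB.
  have -> : E s' z' - E s z - et s z * (s' - s) - ex s z * (z' - z) =
     (s - k.2) * B + (s' - s) * A.
    by rewrite /E /et /ex /B /A; field.
  apply: (le_trans (ler_normD _ _)); rewrite !normrM (gtr0_norm sk).
  have : (s - k.2) * `|B| <= e / 2 * (`|s' - s| + `|z' - z|).
    rewrite mulrC -ler_pdivlMr//; apply: (le_trans HB).
    by rewrite invfM mulrA [leRHS]mulrAC.
  have : `|s' - s| * `|A| <= `|s' - s| * (e / 2) by apply: ler_wpM2l.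
  have : 0 <= e / 2 * `|z' - z| by rewrite mulr_ge0// ltW.
  lra.
pose lam s z := beta * (alpha / 2 - v s z).
have pdeE s z : t0 < s <= t1 -> yl s <= z <= yr s ->
    et s z + lam s z * ex s z = 0.
  move=> sI zI; have := pde s z sI zI; rewrite /et /lam /ex => p.
  have -> : derive1 (v ^~ z) s =
     - (beta * (alpha / 2 - v s z) * derive1 (v s) z).
    by apply/eqP; rewrite -addr_eq0 p.
  by field.
have E0 z : yl t0 <= z <= yr t0 -> E t0 z = 0.
  move=> zI; rewrite /E init// /wave_state; field.
  by rewrite b0 subr_eq0 gt_eqF.
have le0 := transport_max cl cr lr dl dr dE pdeE laxl laxr.
have {}le0 : E t x <= 0 by apply: le0 => // z /E0 ->.
have ge0 := @transport_max _ yl yr yl' yr' (fun s z => - E s z)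
  (fun s z => - et s z) (fun s z => - ex s z) lam t0 t1 cl cr lr dl dr.
have {}ge0 : - E t x <= 0.
  apply: ge0 => //.
  - move=> s z sI zI e e0; have [d d0 H] := dE s z sI zI e e0.
    exists d => // s' z' sd zd.
    have := H s' z' sd zd; rewrite -normrN; congr (`|_| <= _); ring.
  - by move=> s z sI zI; rewrite mulrN -opprD pdeE// oppr0.
  - by move=> z /E0 ->; rewrite oppr0.
have : E t x = 0 by apply/eqP; rewrite eq_le le0 -oppr_le0.
rewrite /E /wave_state => E00.
have tk : t - k.2 != 0.
  by rewrite subr_eq0 gt_eqF//; case/andP: tI => /(lt_le_trans kt0).
apply/eqP; rewrite -subr_eq0; apply/eqP.
have -> : v t x - (alpha / 2 - (x - k.1) / (beta * (t - k.2))) =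
  ((t - k.2) * (v t x - alpha / 2) + (x - k.1) / beta) / (t - k.2).
  by field; rewrite tk b0.
by rewrite E00 mul0r.
Qed.

(* The trace w of u next to an f-interval, with e = 1 on its right and e = -1 on
   its left: (w - u0 - e c)^2 is nonincreasing. *)
Lemma trace_invariant (w sg vx : R -> R) (e t0 t1 : R) :
  e ^+ 2 = 1 -> {within `[t0, t1], continuous w} ->
  (forall t, t0 < t < t1 ->
     is_derive t 1 w (vx t * (sg t - beta * (alpha / 2 - w t)))) ->
  (forall t, t0 < t < t1 -> vx t <= 0) ->
  (forall t, t0 < t < t1 -> sg t * (w t - u0) = g (w t) - f u0) ->
  (forall t, t0 < t < t1 -> 0 < e * (w t - u0)) ->
  w t0 = u0 + e * c ->
  forall t, t0 <= t <= t1 -> w t = u0 + e * c.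
Proof.
move=> e1 cw dw vx0 rh up w0 t /andP[tt0 tt1].
pose h s := (w s - u0 - e * c) ^+ 2.
have : h t <= h t0.
  pose dh s := 2 * (w s - u0 - e * c) *
    (vx s * (sg s - beta * (alpha / 2 - w s))).
  have ts s : t0 < s < t -> t0 < s < t1.
    by move=> /andP[-> /lt_le_trans]; apply.
  apply: (deriv_le0_le (dh := dh) tt0).
  - have cw' : {within `[t0, t], continuous w}.
      apply: continuous_subspaceW cw => z /=; rewrite !in_itv/=.
      by move=> /andP[-> /le_trans]; apply.
    move=> z; apply: (@continuous_comp (subspace `[t0, t]) R R
      (fun s => w s - u0 - e * c) (fun r => r ^+ 2)).
      apply: continuousB; last exact: cst_continuous.
      by apply: continuousB; [exact: cw'|exact: cst_continuous].
    exact: exprn_continuous.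
  - move=> s /ts sI; have := dw s sI => ?.
    apply: is_derive_eq; rewrite /GRing.scale/= /dh; ring.
  - move=> s /ts sI; have v0 := vx0 s sI; have r := rh s sI.
    have m0 := up s sI; rewrite /dh.
    rewrite cE !gE in r.
    (* [S] is the speed of the jump relative to the characteristics. As g is quadratic, S m = beta/2
       (m^2 - c^2); multiplied by m^2 > 0, the product (m - e c) S becomes beta/2 times a square
       times m^2 + e m c, which is positive because e m is. *)
    set S := sg s - _; set m := w s - u0 in m0 *.
    have Sm : S * m = beta / 2 * (m ^+ 2 - c ^+ 2).
      by rewrite /S /m mulrBl r; field.
    have mm : 0 < m ^+ 2.
      rewrite exprn_even_gt0//=; apply/eqP => m00.
      by move: m0; rewrite m00 mulr0 ltxx.
    have : 0 <= (m - e * c) * S.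
      rewrite -(pmulr_lge0 _ mm).
      have -> : (m - e * c) * S * m ^+ 2 =
          m * (m - e * c) * (S * m) by ring.
      rewrite Sm.
      have -> : m * (m - e * c) * (beta / 2 * (m ^+ 2 - c ^+ 2)) =
         beta / 2 * (m - e * c) ^+ 2 * (m ^+ 2 + e * m * c).
        have -> : m ^+ 2 - c ^+ 2 = m ^+ 2 - e ^+ 2 * c ^+ 2 by rewrite e1 mul1r.
        ring.
      apply: mulr_ge0; first by rewrite mulr_ge0 ?sqr_ge0// divr_ge0// ltW.
      by rewrite addr_ge0 ?(ltW mm)// mulr_ge0// ltW.
    have -> : 2 * (m - e * c) * (vx s * S) = vx s * (2 * ((m - e * c) * S)) by ring.
    by move=> ?; rewrite mulr_le0_ge0// mulr_ge0.
rewrite /h w0.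
have -> : (u0 + e * c - u0 - e * c) = 0 by ring.
rewrite expr0n /= => h0; have := sqr_ge0 (w t - u0 - e * c).
move=> h1; have /eqP : (w t - u0 - e * c) ^+ 2 = 0 by apply/eqP; rewrite eq_le h0.
by rewrite sqrf_eq0 => /eqP; lra.
Qed.

End waves.

(** * Continuity on closed intervals and passage to the end points *)

Lemma itv_near {R : realType} (a b t d : R) : a < b -> a <= t <= b -> 0 < d ->
  exists2 s, a < s < b & `|s - t| < d.
Proof.
move=> ab /andP[a_t tb] d0; have [tb'|bt] := ltP t b.
  set m := Num.min d (b - t).
  have m0 : 0 < m by rewrite lt_min d0 subr_gt0.
  have md : m <= d by rewrite ge_min lexx.
  have mb : m <= b - t by rewrite ge_min lexx orbT.
  exists (t + m / 2); first by apply/andP; split; lra.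
  by rewrite addrC addKr gtr0_norm; lra.
set m := Num.min d (b - a).
have m0 : 0 < m by rewrite lt_min d0 subr_gt0.
have md : m <= d by rewrite ge_min lexx.
have mb : m <= b - a by rewrite ge_min lexx orbT.
exists (t - m / 2); first by apply/andP; split; lra.
by rewrite addrC addKr normrN gtr0_norm; lra.
Qed.

Lemma within_ge0 {R : realType} (h : R -> R) (a b : R) : a < b ->
  {within `[a, b], continuous h} -> (forall t, a < t < b -> 0 <= h t) ->
  forall t, a <= t <= b -> 0 <= h t.
Proof.
move=> ab /within_itvP hc h0 t tI; rewrite leNgt; apply/negP => ht.
have e0 : 0 < - h t / 2 by rewrite divr_gt0// oppr_gt0.
have [d d0 H] := hc t tI _ e0.
have [s sI sd] := itv_near ab tI d0.
have /H/(_ sd) : a <= s <= b by case/andP: sI => /ltW -> /ltW ->.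
by have := h0 s sI; rewrite ler_norml => ? /andP[? ?]; lra.
Qed.

Lemma within_le {R : realType} (h k : R -> R) (a b : R) : a < b ->
  {within `[a, b], continuous h} -> {within `[a, b], continuous k} ->
  (forall t, a < t < b -> h t <= k t) ->
  forall t, a <= t <= b -> h t <= k t.
Proof.
move=> ab ch ck hk t tI; rewrite -subr_ge0.
apply: (within_ge0 (h := k \- h) ab _ _ tI) => [s|s sI]; last first.
  by rewrite /= subr_ge0 hk.
by apply: continuousB; [exact: ck|exact: ch].
Qed.

Lemma within_eq {R : realType} (h k : R -> R) (a b : R) : a < b ->
  {within `[a, b], continuous h} -> {within `[a, b], continuous k} ->
  (forall t, a < t < b -> h t = k t) ->
  forall t, a <= t <= b -> h t = k t.
Proof.
move=> ab ch ck hk t tI; apply/eqP; rewrite eq_le.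
by rewrite (within_le ab ch ck)//= => [|s /hk ->//]; apply: within_le tI => // s /hk ->.
Qed.

Lemma within_subitv {R : realType} (h : R -> R) (a b s t : R) :
  a <= s -> t <= b -> {within `[a, b], continuous h} ->
  {within `[s, t], continuous h}.
Proof.
move=> sa tb; apply: continuous_subspaceW => z /=; rewrite !in_itv/=.
by move=> /andP[/(le_trans sa) -> /le_trans]; apply.
Qed.

Lemma within_comp {R : realType} (E : R -> R -> R) (h : R -> R) (a b : R) :
  {within `[a, b], continuous h} ->
  (forall t, a <= t <= b ->
     {for ((t, h t) : R * R), continuous (fun p : R * R => E p.1 p.2)}) ->
  {within `[a, b], continuous (fun t => E t (h t))}.
Proof.
move=> ch cE; apply/subspace_continuousP => t tI.
apply/cvgrPdist_le => e e0; rewrite near_withinE.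
have /continuous_pairP/(_ e e0)[d d0 H] := cE t tI.
have d2 : 0 < d / 2 by rewrite divr_gt0.
have [d' d'0 H'] := within_itvP ch tI d2.
apply/nbhs_ballP; exists (Num.min d d'); first by rewrite /= lt_min d0.
move=> s; rewrite /ball /= distrC lt_min => /andP[sd sd'] sI; rewrite distrC.
apply: H => //; apply: le_lt_trans (H' s sI sd') _.
by rewrite ltr_pdivrMr// ltr_pMr// ltr1n.
Qed.

Lemma within_pair_x {R : realType} (E : R -> R -> R) (t l r : R) :
  (forall x, l <= x <= r ->
     {for ((t, x) : R * R), continuous (fun p : R * R => E p.1 p.2)}) ->
  {within `[l, r], continuous (E t)}.
Proof.
move=> cE; apply/subspace_continuousP => x xI.
apply/cvgrPdist_le => e e0; rewrite near_withinE.
have /continuous_pairP/(_ e e0)[d d0 H] := cE x xI.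
apply/nbhs_ballP; exists d => // z; rewrite /ball /= distrC => zd _.
by rewrite distrC; apply: H; rewrite ?subrr ?normr0.
Qed.

Lemma within_add {R : realType} (h k : R -> R) (A : set R) :
  {within A, continuous h} -> {within A, continuous k} ->
  {within A, continuous (fun x => h x + k x)}.
Proof. by move=> ch ck x; apply: continuousD; [exact: ch|exact: ck]. Qed.

Lemma within_cst {R : realType} (k : R) (A : set R) :
  {within A, continuous (fun=> k : R)}.
Proof. by move=> x; exact: cst_continuous. Qed.

Lemma within_sub {R : realType} (h k : R -> R) (A : set R) :
  {within A, continuous h} -> {within A, continuous k} ->
  {within A, continuous (fun x => h x - k x)}.
Proof. by move=> ch ck x; apply: continuousB; [exact: ch|exact: ck]. Qed.

Lemma within_mul {R : realType} (h k : R -> R) (A : set R) :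
  {within A, continuous h} -> {within A, continuous k} ->
  {within A, continuous (fun x => h x * k x)}.
Proof. by move=> ch ck x; apply: continuousM; [exact: ch|exact: ck]. Qed.

(** * Families of points indexed by the integers *)

(** Translation by multiples of L yields an index whose value is at most x and a later one whose
    value exceeds x; some step in between crosses x. *)
Lemma int_locate {R : realType} (z : int -> R) (n : nat) (L : R) :
  0 < L -> (forall i, z (i + n%:Z) = z i + L) ->
  forall x, exists i, z i <= x < z (i + 1).
Proof.
move=> L0 zn x.
have zup (m : nat) i : z (i + (n * m)%N%:Z) = z i + L *+ m.
  elim: m => [|m IH]; first by rewrite muln0 addr0 mulr0n addr0.
  by rewrite mulnS addnC PoszD addrA zn IH mulrSr addrA.
have [m Hm] : exists m : nat, `|x - z 0| < L *+ m.
  exists (Num.truncn (`|x - z 0| / L)).+1.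
  have := truncnS_gt (`|x - z 0| / L).
  by rewrite ltr_pdivrMr// mulr_natl.
move: Hm; rewrite ltr_norml => /andP[Hm1 Hm2].
have [i zi] : exists i, z i = z 0 - L *+ m.
  by exists (- (n * m)%N%:Z); have := zup m (- (n * m)%N%:Z); rewrite addNr; lra.
have lo : z i <= x by rewrite zi; lra.
have hi : x < z (i + (n * (m + m))%N%:Z) by rewrite zup zi mulrnDr; lra.
move: (n * (m + m))%N lo hi => k {zi}.
elim: k i => [|k IH] i lo; first by rewrite addr0 ltNge lo.
have [xi|xi] := ltP x (z (i + 1)); first by exists i; rewrite lo.
move=> hi; apply: (IH (i + 1) xi).
by rewrite -addrA -PoszD add1n.
Qed.

Lemma int_addS (i : int) (n : nat) : i + n.+1%:Z = i + n%:Z + 1.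
Proof. by lia. Qed.

Lemma int_le_add (i j : int) : i <= j -> exists k : nat, j = i + k%:Z.
Proof. by move=> ij; exists `|j - i|%N; lia. Qed.

Lemma int_nondecreasing {R : realType} (z : int -> R) :
  (forall i, z i <= z (i + 1)) -> forall i j, i <= j -> z i <= z j.
Proof.
move=> zS i j ij; have [k ->] := int_le_add ij.
elim: k => [|k IH]; first by rewrite addr0.
by apply: (le_trans IH); rewrite int_addS.
Qed.

Lemma wave_state_continuous {R : realType} (alpha beta u0 : R) K t (A : set R) :
  {within A, continuous (wave_state alpha beta u0 K t)}.
Proof.
case: K => [k|]; last exact: within_cst.
apply: within_sub; first exact: within_cst.
apply: (within_mul (h := fun x => x - k.1)); last exact: within_cst.
apply: within_sub; last exact: within_cst.
by apply: continuous_subspaceT => x; exact: cvg_id.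
Qed.

(** * One slab: closed pieces and propagation along the g-pieces *)

Section slab.
Variables (R : realType) (f g : R -> R) (alpha beta L u0 c : R).
Hypothesis beta0 : 0 < beta.
Hypothesis c0 : 0 < c.
Hypothesis L0 : 0 < L.
Hypothesis gE : forall w, g w = beta / 2 * w * (alpha - w).
Hypothesis cE : f u0 = g u0 + beta * c ^+ 2 / 2.
Local Notation state := (wave_state alpha beta u0).
Local Notation pot := (wave_pot alpha beta u0 c).
Local Notation speed := (beta * (alpha / 2 - u0)).

Variables (u : R -> R -> R) (theta : R -> R -> bool) (a b : R).
Variables (y : int -> R -> R) (v : int -> R -> R -> R) (th : int -> bool).
Hypothesis ab : a < b.
Hypothesis S : front_slab f g L u0 u theta a b y v th.

Lemma slab_cont i : {within `[a, b], continuous (y i)}.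
Proof. by move=> x; apply: (fs_cont S). Qed.

Lemma slab_le i t : a <= t <= b -> y i t <= y (i + 1) t.
Proof.
apply: (within_le ab (@slab_cont i) (@slab_cont (i + 1))).
by move=> s sI; exact: ltW (fs_order S i sI).
Qed.

Lemma slab_mono t i j : a <= t <= b -> i <= j -> y i t <= y j t.
Proof.
by move=> tI; apply: (int_nondecreasing (z := y ^~ t)) => k; exact: slab_le.
Qed.

Lemma slab_locate t x : a <= t <= b -> exists i, y i t <= x < y (i + 1) t.
Proof.
move=> tI; have [n n0 yn] := fs_period S.
by apply: (int_locate (z := y ^~ t) (n := n) L0) => i; exact: yn.
Qed.

Lemma slab_C1 i t x : a <= t <= b -> y i t < y (i + 1) t ->
  y i t <= x <= y (i + 1) t -> C1_at (v i) t x.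
Proof. exact: fs_C1 S i t x. Qed.

Lemma slab_v_within i t : a <= t <= b -> y i t < y (i + 1) t ->
  {within `[y i t, y (i + 1) t], continuous (v i t)}.
Proof.
move=> tI yy; apply: within_pair_x => x xI.
by have /C1_at_frechet/frechet_continuous := slab_C1 tI yy xI.
Qed.

(** Regularity up to the jumps carries the interior conditions to the closed piece, here and in the
    next two lemmas; the traces at the jumps need them. *)
Lemma slab_f i t x : th i -> a <= t <= b -> y i t < y (i + 1) t ->
  y i t <= x <= y (i + 1) t -> v i t x = u0.
Proof.
move=> thi tI yy; apply: (within_eq yy (slab_v_within tI yy)).
  exact: within_cst.
by move=> z zI; exact: (fs_f S) zI thi.
Qed.

Lemma slab_slope i t x : ~~ th i -> a <= t <= b -> y i t < y (i + 1) t ->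
  y i t <= x <= y (i + 1) t -> derive1 (v i t) x <= 0.
Proof.
move=> thi tI yy; apply: (within_le yy).
- apply: (within_pair_x (E := fun t => derive1 (v i t))) => z zI.
  by have [_ _ H] := slab_C1 tI yy zI; exact: H.
- exact: within_cst.
- by move=> z zI; have [/ltW] := fs_g S tI zI thi.
Qed.

Lemma slab_pde i t x : ~~ th i -> a <= t <= b -> y i t < y (i + 1) t ->
  y i t <= x <= y (i + 1) t ->
  derive1 (v i ^~ x) t + beta * (alpha / 2 - v i t x) * derive1 (v i t) x = 0.
Proof.
move=> thi tI yy.
pose F z := derive1 (v i ^~ z) t +
  beta * (alpha / 2 - v i t z) * derive1 (v i t) z.
apply: (within_eq (h := F) yy).
- have ct : {within `[y i t, y (i + 1) t],
      continuous (fun z => derive1 (v i ^~ z) t)}.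
    apply: (within_pair_x (E := fun t z => derive1 (v i ^~ z) t)) => z zI.
    by have [_ H _] := slab_C1 tI yy zI; exact: H.
  have cx : {within `[y i t, y (i + 1) t], continuous (derive1 (v i t))}.
    apply: (within_pair_x (E := fun t => derive1 (v i t))) => z zI.
    by have [_ _ H] := slab_C1 tI yy zI; exact: H.
  apply: (within_add ct); apply: within_mul cx.
  apply: (within_mul (h := fun=> beta) (k := fun z => alpha / 2 - v i t z)).
    exact: within_cst.
  apply: (within_sub (h := fun=> alpha / 2) (k := v i t)).
    exact: within_cst.
  exact: slab_v_within.
- exact: within_cst.
- move=> z zI; have [_ <-] := fs_g S tI zI thi; congr (_ + _).
  have zI' : y i t <= z <= y (i + 1) t by case/andP: zI => /ltW -> /ltW ->.
  have := frechet_x (C1_at_frechet (slab_C1 tI yy zI')) => dv.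
  have -> : (fun z => g (v i t z)) =
      (fun z => beta / 2 * v i t z * (alpha - v i t z)).
    by apply/funext => z'; rewrite gE.
  apply/esym/is_derive_derive1; apply: is_derive_eq.
  by rewrite /GRing.scale/=; field.
Qed.

Lemma slab_speed i t : a < t < b -> is_derive t 1 (y i) (derive1 (y i) t).
Proof. by move=> tI; have [/derivable_is_derive1] := fs_RankineHugoniot S i tI. Qed.

Lemma slab_RH i t : a < t < b ->
  derive1 (y i) t * (v i t (y i t) - v (i - 1) t (y i t)) =
  flux f g (th i) (v i t (y i t)) - flux f g (th (i - 1)) (v (i - 1) t (y i t)).
Proof. by move=> tI; have [] := fs_RankineHugoniot S i tI. Qed.

Lemma slab_lt i t : a < t < b -> y i t < y (i + 1) t.
Proof. exact: fs_order S i t. Qed.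

Lemma oo_cc (s : R) : a < s < b -> a <= s <= b.
Proof. by case/andP => /ltW -> /ltW ->. Qed.

Lemma slab_left_f i t : a < t < b -> th (i - 1) -> v (i - 1) t (y i t) = u0.
Proof.
move=> tI thi; have := slab_lt (i - 1) tI; rewrite subrK => lt1.
by apply: slab_f; rewrite ?subrK ?oo_cc// lexx ltW.
Qed.

Lemma slab_right_f i t : a < t < b -> th i -> v i t (y i t) = u0.
Proof.
move=> tI thi; apply: slab_f; rewrite ?oo_cc ?slab_lt// lexx ltW//.
exact: slab_lt.
Qed.

(** Between two f-pieces both traces would be u0, whereas jumps are strictly upward. *)
Lemma slab_f_isolated i : th i -> ~~ th (i - 1).
Proof.
move=> thi; apply/negP => thi1.
have tI : a < (a + b) / 2 < b by rewrite !midf_lt.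
by have := fs_upward S i tI; rewrite slab_left_f// slab_right_f// ltxx.
Qed.

(** Traces next to f-pieces are frozen by [trace_invariant]; the lateral conditions of
    [piece_evolution] then hold, since a jump is sonic against an f-piece and a compressive shock
    against a g-piece. The bound t1 < b is there because the piece may close at b. *)
Lemma slab_evolution i k t0 t1 : a <= t0 -> t0 <= t1 -> t1 < b ->
  y i t0 < y (i + 1) t0 -> ~~ th i -> k.2 < t0 ->
  (forall x, y i t0 < x < y (i + 1) t0 -> v i t0 x = state (Some k) t0 x) ->
  (th (i - 1) -> v i t0 (y i t0) = u0 + c) ->
  (th (i + 1) -> v i t0 (y (i + 1) t0) = u0 - c) ->
  forall t, t0 <= t <= t1 ->
  [/\ forall x, y i t <= x <= y (i + 1) t -> v i t x = state (Some k) t x,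
      th (i - 1) -> v i t (y i t) = u0 + c
    & th (i + 1) -> v i t (y (i + 1) t) = u0 - c].
Proof.
move=> at0 t01 t1b yy0 thi kt0 init trl trr.
have cc t : t0 <= t <= t1 -> a <= t <= b.
  by move=> /andP[? ?]; apply/andP; split; lra.
have oc t : t0 < t <= t1 -> a < t < b.
  by move=> /andP[? ?]; apply/andP; split; lra.
have oo t : t0 < t < t1 -> a < t < b.
  by move=> /andP[? ?]; apply/andP; split; lra.
have yy t : t0 <= t <= t1 -> y i t < y (i + 1) t.
  move=> /andP[]; rewrite le_eqVlt => /predU1P[<-//|tt0 tt1].
  by apply: slab_lt; apply: oc; rewrite tt0.
have inl t : t0 <= t <= t1 -> y i t <= y i t <= y (i + 1) t.
  by move=> tI; rewrite lexx ltW// yy.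
have inr t : t0 <= t <= t1 -> y i t <= y (i + 1) t <= y (i + 1) t.
  by move=> tI; rewrite lexx ltW// yy.
have cl j : {within `[t0, t1], continuous (y j)}.
  exact: within_subitv at0 (ltW t1b) (@slab_cont j).
have C1 t x : t0 <= t <= t1 -> y i t <= x <= y (i + 1) t -> C1_at (v i) t x.
  by move=> tI; apply: slab_C1; rewrite ?cc ?yy.
have dtr (j : int) (t : R) : t0 < t < t1 -> y i t <= y j t <= y (i + 1) t ->
    is_derive t 1 (fun s => v i s (y j s)) (derive1 (v i t) (y j t) *
      (derive1 (y j) t - beta * (alpha / 2 - v i t (y j t)))).
  move=> tI yI; have tI' := oo t tI.
  have C1' := slab_C1 (oo_cc tI') (slab_lt i tI') yI.
  have := frechet_chain (C1_at_frechet C1') (slab_speed j tI').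
  have := slab_pde thi (oo_cc tI') (slab_lt i tI') yI.
  set A := derive1 _ t; set B := derive1 (v i t) _.
  move=> pde dv; suff -> : B * (derive1 (y j) t -
      beta * (alpha / 2 - v i t (y j t))) = A + B * derive1 (y j) t by [].
  by move/eqP: pde; rewrite addr_eq0 => /eqP ->; ring.
have ctr (j : int) : (forall t, t0 <= t <= t1 -> y i t <= y j t <= y (i + 1) t) ->
    {within `[t0, t1], continuous (fun s => v i s (y j s))}.
  move=> yI; apply: within_comp; first exact: cl.
  by move=> t tI; exact: frechet_continuous (C1_at_frechet (C1 t _ tI (yI t tI))).
have oo' t : t0 < t < t1 -> t0 <= t <= t1.
  by case/andP => /ltW -> /ltW ->.
have {}trl t : t0 <= t <= t1 -> th (i - 1) -> v i t (y i t) = u0 + c.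
  move=> tI thl; have -> : u0 + c = u0 + 1 * c by rewrite mul1r.
  apply: (trace_invariant beta0 c0 gE cE (expr1n _ _) (ctr i inl)
    (fun t tI => dtr i t tI (inl t (oo' t tI)))) => //.
  - move=> s sI; apply: slab_slope; rewrite ?oo_cc// ?oo// ?slab_lt ?oo//.
    exact/inl/oo'.
  - move=> s sI; have := slab_RH i (oo s sI).
    by rewrite (slab_left_f (oo s sI) thl) (negbTE thi) thl.
  - move=> s sI; have := fs_upward S i (oo s sI).
    by rewrite (slab_left_f (oo s sI) thl) mul1r subr_gt0.
  - by rewrite mul1r trl.
have {}trr t : t0 <= t <= t1 -> th (i + 1) -> v i t (y (i + 1) t) = u0 - c.
  move=> tI thr; have -> : u0 - c = u0 + (-1) * c by rewrite mulN1r.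
  apply: (trace_invariant beta0 c0 gE cE (etrans (sqrrN 1) (expr1n _ _)) (ctr (i + 1) inr)
    (fun t tI => dtr (i + 1) t tI (inr t (oo' t tI)))) => //.
  - move=> s sI; apply: slab_slope; rewrite ?oo_cc// ?oo// ?slab_lt ?oo//.
    exact/inr/oo'.
  - move=> s sI; have := slab_RH (i + 1) (oo s sI).
    rewrite addrK (slab_right_f (oo s sI) thr) (negbTE thi) thr /=; lra.
  - move=> s sI; have := fs_upward S (i + 1) (oo s sI).
    by rewrite addrK (slab_right_f (oo s sI) thr); lra.
  - by rewrite mulN1r trr.
move=> t tI; split; [|exact: trl|exact: trr].
move=> x xI.
apply: (piece_evolution beta0 kt0 (cl i) (cl (i + 1)) yy
  (fun t tI => slab_speed i (oc t tI))
  (fun t tI => slab_speed (i + 1) (oc t tI)) C1) => //.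
- by move=> s z sI zI; apply: slab_pde => //; rewrite ?oo_cc ?oc ?slab_lt ?oc.
- move=> s sI; have sI' : t0 <= s <= t1 by case/andP: sI => /ltW -> ->.
  have := slab_RH i (oc s sI); have := fs_upward S i (oc s sI).
  rewrite (negbTE thi) /=.
  have [thl|thl] /= := boolP (th (i - 1)).
    (* At amplitude c the jump has the characteristic speed of its g-side: the lateral condition is
       an equality. *)
    rewrite (slab_left_f (oc s sI) thl) trl// => _.
    rewrite cE !gE => E; have {}E : derive1 (y i) s * c = beta * (alpha / 2 - (u0 + c)) * c.
      have -> : derive1 (y i) s * c = derive1 (y i) s * (u0 + c - u0) by ring.
      by rewrite E; field.
    by have /(mulIf (lt0r_neq0 c0)) -> := E.
  (* Between g-pieces the jump moves at the mean of the two characteristic speeds, and the right one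
     is the smaller since the jump is upward. *)
  set w := v i s _; set w' := v _ s _ => ww; rewrite !gE => E.
  rewrite -(@ler_pM2r _ (w - w')) ?subr_gt0// E.
  have -> : beta / 2 * w * (alpha - w) - beta / 2 * w' * (alpha - w') =
    beta * (alpha / 2 - w) * (w - w') + beta / 2 * (w - w') ^+ 2 by field.
  by rewrite lerDl mulr_ge0 ?sqr_ge0// divr_ge0// ltW.
- move=> s sI; have sI' : t0 <= s <= t1 by case/andP: sI => /ltW -> ->.
  have := slab_RH (i + 1) (oc s sI); have := fs_upward S (i + 1) (oc s sI).
  rewrite addrK (negbTE thi) /=.
  have [thl|thl] /= := boolP (th (i + 1)).
    rewrite (slab_right_f (oc s sI) thl) trr// => _.
    rewrite cE !gE => E; have {}E : derive1 (y (i + 1)) s * c =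
        beta * (alpha / 2 - (u0 - c)) * c.
      have -> : derive1 (y (i + 1)) s * c =
        derive1 (y (i + 1)) s * (u0 - (u0 - c)) by ring.
      by rewrite E; field.
    by have /(mulIf (lt0r_neq0 c0)) -> := E.
  set w := v (i + 1) s _; set w' := v _ s _ => ww; rewrite !gE => E.
  rewrite -(@ler_pM2r _ (w - w')) ?subr_gt0// E.
  have -> : beta / 2 * w * (alpha - w) - beta / 2 * w' * (alpha - w') =
    beta * (alpha / 2 - w') * (w - w') - beta / 2 * (w - w') ^+ 2 by field.
  by rewrite gerBl mulr_ge0 ?sqr_ge0// divr_ge0// ltW.
- move=> z zI; have t0I : a <= t0 <= b by apply/andP; split; lra.
  apply: (within_eq yy0 (slab_v_within t0I yy0)) zI => //.
  exact: wave_state_continuous.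
Qed.

End slab.

(** * Right neighbourhoods, periodicity, continuity of waves along curves *)

Lemma near_right {R : realType} (a : R) (Q : R -> Prop) :
  (\forall t \near a^'+, Q t) ->
  exists2 d, 0 < d & forall t, a < t < a + d -> Q t.
Proof.
rewrite /at_right near_withinE => /nbhs_ballP[d /= d0 H].
exists d => // t /andP[at_ td]; apply: H => //.
by rewrite /ball /= distrC gtr0_norm ?subr_gt0// ltrBlDl.
Qed.

Lemma int_periodic {R : realType} (Q : R -> Prop) (L : R) :
  (forall x, Q x <-> Q (x + L)) -> forall (m : int) x, Q x <-> Q (x + m%:~R * L).
Proof.
move=> QL; have Qn (n : nat) x : Q x <-> Q (x + n%:R * L).
  elim: n x => [|n IH] x; first by rewrite mul0r addr0.
  by rewrite (QL x) (IH (x + L)) -addrA mulrS mulrDl mul1r.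
case=> n x; first exact: Qn.
rewrite NegzE mulrNz mulNr; have := Qn n.+1 (x - n.+1%:R * L).
by rewrite subrK => ->.
Qed.

Lemma within_inv {R : realType} (h : R -> R) (a b : R) :
  (forall x, a <= x <= b -> h x != 0) -> {within `[a, b], continuous h} ->
  {within `[a, b], continuous (fun x => (h x)^-1)}.
Proof.
move=> h0 /subspace_continuousP ch; apply/subspace_continuousP => x xI.
by apply: cvgV; [exact: h0|exact: ch].
Qed.

Lemma within_id {R : realType} (A : set R) :
  {within A, continuous (fun x : R => x)}.
Proof. by apply: continuous_subspaceT => x; exact: cvg_id. Qed.

Lemma within_wave_state {R : realType} (alpha beta u0 : R) K (h : R -> R)
    (a b : R) : 0 < beta -> (forall k, K = Some k -> k.2 < a) ->
  {within `[a, b], continuous h} ->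
  {within `[a, b], continuous (fun t => wave_state alpha beta u0 K t (h t))}.
Proof.
move=> beta0; case: K => [k|] ka ch; last exact: within_cst.
have {}ka := ka k erefl.
apply: (within_sub (h := fun=> alpha / 2)); first exact: within_cst.
apply: (within_mul (h := fun t => h t - k.1)).
  by apply: (within_sub (h := h)) => //; exact: within_cst.
apply: (within_inv (h := fun t => beta * (t - k.2))) => [x /andP[ax _]|].
  by rewrite mulf_neq0 ?gt_eqF// subr_gt0 (lt_le_trans ka).
apply: (within_mul (h := fun=> beta)); first exact: within_cst.
by apply: (within_sub (h := fun t => t)); [exact: within_id|exact: within_cst].
Qed.

Lemma within_wave_pot {R : realType} (alpha beta u0 c : R) K (h : R -> R)
    (a b : R) : 0 < beta -> (forall k, K = Some k -> k.2 < a) ->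
  {within `[a, b], continuous h} ->
  {within `[a, b], continuous (fun t => wave_pot alpha beta u0 c K t (h t))}.
Proof.
move=> beta0; case: K => [k|] ka ch; last exact: within_cst.
have {}ka := ka k erefl.
have ct : {within `[a, b], continuous (fun t => t - k.2)}.
  by apply: (within_sub (h := fun t => t)); [exact: within_id|exact: within_cst].
apply: within_sub; last by apply: within_mul ct; exact: within_cst.
apply: within_mul.
  have cc : {within `[a, b], continuous
      (fun t => h t - k.1 - beta * (alpha / 2 - u0) * (t - k.2))}.
    apply: within_sub; last by apply: within_mul ct; exact: within_cst.
    by apply: (within_sub (h := h)) => //; exact: within_cst.
  exact: (within_mul cc cc).
apply: within_inv => [x /andP[ax _]|].
  by rewrite !mulf_neq0 ?gt_eqF// subr_gt0 (lt_le_trans ka).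
by apply: within_mul ct; exact: within_cst.
Qed.

(** * The invariant at the times s k and over the slabs *)

Section profile.
Variables (R : realType) (alpha beta L u0 c T1 : R).
Variables (u : R -> R -> R) (theta : R -> R -> bool).

(* The two ends of an f-interval approach each other at the speed 2 beta c. *)
Definition f_width (t : R) : R := L - 2 * beta * c * (t - T1).

Definition f_end : R := T1 + L / (2 * beta * c).

(* The solution at time a, before the insertions: P is the set of jumps, K x
   the wave at x. *)
Record wave_profile (a : R) (P : set R) (K : R -> option (R * R)) : Prop :=
  WaveProfile {
    wp_period : forall x, P x <-> P (x + L);
    wp_state : forall x, ~ P x -> u a x = wave_state alpha beta u0 (K x) a x /\
      theta a x = ~~ isSome (K x);
    wp_time : forall x k, ~ P x -> K x = Some k -> k.2 < a /\ k.2 <= f_end;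
    wp_const : forall x x', x <= x' -> (forall z, x <= z <= x' -> ~ P z) ->
      K x = K x';
    wp_match : forall p x x', x < p < x' ->
      (forall z, x <= z <= x' -> z != p -> ~ P z) ->
      wave_pot alpha beta u0 c (K x) a p = wave_pot alpha beta u0 c (K x') a p;
    wp_width : forall x x', x <= x' -> (forall z, x <= z <= x' -> ~ P z) ->
      K x = None -> a <= T1 \/ x' - x <= f_width a
  }.

(** The invariant over ]a, b]. Time a is left out because a spike inserted then has its apex there;
    hence also the weak inequality on emission times, strict in [wave_profile]. *)
Record slab_waves (a b : R) (y : int -> R -> R) (th : int -> bool)
    (K : int -> option (R * R)) : Prop :=
  SlabWaves {
    sw_th : forall i, th i = ~~ isSome (K i);
    sw_time : forall i k, K i = Some k -> k.2 <= a /\ k.2 <= f_end;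
    sw_state : forall i t x, a < t <= b -> y i t < x < y (i + 1) t ->
      u t x = wave_state alpha beta u0 (K i) t x;
    sw_match : forall i t, a < t <= b ->
      wave_pot alpha beta u0 c (K (i - 1)) t (y i t) =
      wave_pot alpha beta u0 c (K i) t (y i t);
    sw_upward : forall i t, a < t <= b ->
      wave_state alpha beta u0 (K (i - 1)) t (y i t) <=
      wave_state alpha beta u0 (K i) t (y i t);
    sw_width : forall i t, K i = None -> a < t <= b ->
      y (i + 1) t - y i t <= f_width t
  }.
End profile.

(** * From the profile at a to the waves on ]a, b] *)

Section step.
Variables (R : realType) (f g : R -> R) (alpha beta L u0 c T1 : R).
Hypothesis beta0 : 0 < beta.
Hypothesis c0 : 0 < c.
Hypothesis L0 : 0 < L.
Hypothesis gE : forall w, g w = beta / 2 * w * (alpha - w).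
Hypothesis cE : f u0 = g u0 + beta * c ^+ 2 / 2.
Local Notation state := (wave_state alpha beta u0).
Local Notation pot := (wave_pot alpha beta u0 c).
Local Notation speed := (beta * (alpha / 2 - u0)).

Variables (u : R -> R -> R) (theta : R -> R -> bool) (a b : R).
Variables (y : int -> R -> R) (v : int -> R -> R -> R) (th : int -> bool).
Variables (T X : nat -> R) (P : set R) (K : R -> option (R * R)).
Hypothesis ab : a < b.
Hypothesis T1a : T1 <= a.
Hypothesis theta_per : forall x, theta a (x + L) = theta a x.
Hypothesis S : front_slab f g L u0 u theta a b y v th.
Hypothesis St : front_start alpha beta u a P (insertions L T X theta a P) y.
Hypothesis Pr : wave_profile alpha beta L u0 c T1 u theta a P K.
Local Notation Ins := (insertions L T X theta a P).
Local Notation width := (f_width beta L c T1).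
Local Notation Tend := (f_end beta L c T1).

Let acc : a <= a <= b. Proof. by rewrite lexx ltW. Qed.
Let mono := slab_mono ab S.

Lemma insertion_f p : Ins p -> ~ P p /\ theta a p.
Proof.
move=> [j [m [_ _ nP thX ->]]].
have H1 := (int_periodic (wp_period Pr) m (X j)).
have H2 := @int_periodic _ (fun x => theta a x) L _ m (X j).
split; first by move=> /H1.
by apply/H2 => // x; rewrite theta_per.
Qed.

Lemma start_no_jump i z : y i a < z < y (i + 1) a -> ~ P z.
Proof.
move=> /andP[z1 z2] Pz.
have : (P `|` Ins) z by left.
rewrite -(st_range St) => -[j _ /= jz].
have [ji|ij] := leP j i.
  by move: z1; rewrite -jz ltNge mono.
by move: z2; rewrite -jz ltNge mono//; lia.
Qed.

(** Such a piece, reduced to a point at time a, is a new spike: older jumps that meet at a have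
    merged into one. *)
Definition spiked i := ~~ (y i a < y (i + 1) a).

Lemma spikedP i : spiked i -> [/\ y i a = y (i + 1) a, Ins (y i a),
  y (i - 1) a < y i a & y (i + 1) a < y (i + 1 + 1) a].
Proof.
rewrite /spiked => /negP n; have E : y i a = y (i + 1) a.
  apply/eqP; rewrite eq_le (slab_le ab S)//= leNgt; exact/negP.
split=> //; first by have [|//] := st_single St i; move/n.
- by have := st_no_three St (i - 1); have -> : i - 1 + 2 = i + 1 by [lia]; rewrite -E.
- by have := st_no_three St i; have -> : i + 2 = i + 1 + 1 by [lia]; rewrite E.
Qed.

Let mid i := (y i a + y (i + 1) a) / 2.

(** The wave carried by piece i after a. The midpoint is an arbitrary sample, as the profile is
    constant on the open piece ([slab_waveE]). *)
Definition slab_wave i : option (R * R) :=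
  if y i a < y (i + 1) a then K (mid i) else Some (y i a, a).
Local Notation Kp := slab_wave.

Lemma mid_in i : y i a < y (i + 1) a -> y i a < mid i < y (i + 1) a.
Proof. by move=> yy; rewrite !midf_lt. Qed.

Lemma slab_waveE i x : y i a < x < y (i + 1) a -> K x = Kp i.
Proof.
move=> xI; have yy : y i a < y (i + 1) a by case/andP: xI => /lt_trans; apply.
have mI := mid_in yy; rewrite /slab_wave yy.
case/andP: (xI) => x1 x2; case/andP: mI => m1 m2.
have [xm|mx] := leP x (mid i).
  apply: (wp_const Pr) => // z /andP[z1 z2]; apply: (@start_no_jump i).
  by rewrite (lt_le_trans x1)// (le_lt_trans z2).
apply/esym/(wp_const Pr); first exact: ltW.
move=> z /andP[z1 z2]; apply: (@start_no_jump i).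
by rewrite (lt_le_trans m1)// (le_lt_trans z2).
Qed.

Lemma wave_at_insertion p : Ins p -> K p = None.
Proof.
move=> /insertion_f[nP thp]; have [_] := wp_state Pr nP.
by rewrite thp; case: (K p).
Qed.

(** A spike is inserted away from the jumps and where theta is true, so the profile is constant from
    the adjacent piece up to the insertion point, where it is [None]. *)
Lemma spiked_left i : spiked i -> Kp (i - 1) = None.
Proof.
move=> /spikedP[E /[dup] Iy /insertion_f[nP _] lt1 _].
have lt1' : y (i - 1) a < y (i - 1 + 1) a by rewrite subrK.
have := mid_in lt1'; rewrite subrK => mI.
rewrite -(slab_waveE (i := i - 1) (x := mid (i - 1))); last by rewrite subrK.
rewrite -(wave_at_insertion Iy); case/andP: (mI) => m1 m2.
apply: (wp_const Pr); first exact: ltW.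
move=> z /andP[z1]; rewrite le_eqVlt => /predU1P[->//|z2].
by apply: (@start_no_jump (i - 1)); rewrite subrK z2 (lt_le_trans m1).
Qed.

Lemma spiked_right i : spiked i -> Kp (i + 1) = None.
Proof.
move=> /spikedP[E /[dup] Iy /insertion_f[nP _] _ lt1].
have mI := mid_in lt1.
rewrite -(slab_waveE mI).
rewrite -(wave_at_insertion Iy); case/andP: (mI) => m1 m2.
apply/esym/(wp_const Pr); first by rewrite E ltW.
move=> z /andP[]; rewrite le_eqVlt => /predU1P[<-//|z1] z2.
by apply: (@start_no_jump (i + 1)); rewrite -E z1 (le_lt_trans z2).
Qed.

Lemma spiked_formula i : spiked i -> exists2 d, a < d < b &
  forall t x, a < t <= d -> y i t < x < y (i + 1) t ->
    u t x = state (Some (y i a, a)) t x.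
Proof.
move=> /spikedP[/(st_spike St)/near_right[d d0 H] _ _ _].
have d0' : 0 < Num.min (d / 2) ((b - a) / 2).
  by rewrite lt_min !divr_gt0// subr_gt0.
have d1 : Num.min (d / 2) ((b - a) / 2) <= d / 2 by rewrite ge_min lexx.
have d2 : Num.min (d / 2) ((b - a) / 2) <= (b - a) / 2.
  by rewrite ge_min lexx orbT.
exists (a + Num.min (d / 2) ((b - a) / 2)).
  by have := ab => ?; apply/andP; split; lra.
move=> t x /andP[t1 t2]; apply: H; rewrite t1/=.
by apply: (le_lt_trans t2); rewrite ltrD2l (le_lt_trans d1)// ltr_pdivrMr// ltr_pMr// ltr1n.
Qed.

Lemma slab_thE i : th i = ~~ isSome (Kp i).
Proof.
rewrite /slab_wave; case: ifPn => [yy|sp].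
  have mI := mid_in yy.
  have [_ <-] := fs_state S acc mI.
  by have [_ ->] := wp_state Pr (start_no_jump mI).
(* With flux f a spiked piece would have u = u0, but the spike formula is affine with nonzero slope:
   two points are compared. *)
apply/negbTE/negP => thi.
have [d dI H] := spiked_formula sp.
have dI' : a < d <= d by rewrite lexx andbT; case/andP: dI.
have yy := slab_lt S i dI.
set l := y i d in yy *; set r := y (i + 1) d in yy *.
have st x : l < x < r -> state (Some (y i a, a)) d x = u0.
  move=> xI; rewrite -(H d x)//.
  by have [-> _] := fs_state S (oo_cc dI) xI; exact: (fs_f S (oo_cc dI) xI thi).
have := st (l + (r - l) / 3); have := st (l + (r - l) / 2).
have I2 : l < l + (r - l) / 2 < r by apply/andP; split; lra.
have I3 : l < l + (r - l) / 3 < r by apply/andP; split; lra.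
move=> /(_ I2) <- /(_ I3); rewrite /wave_state /= => /addrI/oppr_inj.
have da : beta * (d - a) != 0.
  by rewrite mulf_neq0 ?gt_eqF// subr_gt0; case/andP: dI.
by move=> /(mulIf (invr_neq0 da)); lra.
Qed.

Lemma slab_wave_time i k : Kp i = Some k -> k.2 <= a.
Proof.
rewrite /slab_wave; case: ifPn => [yy kE|_ [<-]//].
by have [/ltW] := wp_time Pr (start_no_jump (mid_in yy)) kE.
Qed.

Lemma unspiked_time i k : ~~ spiked i -> Kp i = Some k -> k.2 < a.
Proof.
rewrite /slab_wave => /negPn yy; rewrite yy => kE.
by have [] := wp_time Pr (start_no_jump (mid_in yy)) kE.
Qed.

Lemma unspiked_match i : ~~ spiked (i - 1) -> ~~ spiked i ->
  pot (Kp (i - 1)) a (y i a) = pot (Kp i) a (y i a).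
Proof.
move=> /negPn l /negPn r.
have := mid_in l; have := mid_in r; rewrite subrK => rI lI.
have <- := slab_waveE rI.
rewrite -(slab_waveE (i := i - 1) (x := mid (i - 1))); last by rewrite subrK.
case/andP: lI rI => [m1 m2] /andP[m3 m4].
apply: (wp_match Pr); first by rewrite m2.
move=> z /andP[z1 z2] zy.
have [zl|zr] := ltP z (y i a).
  by apply: (@start_no_jump (i - 1)); rewrite subrK zl (lt_le_trans m1).
apply: (@start_no_jump i); rewrite (le_lt_trans z2)// andbT.
by rewrite lt_neqAle eq_sym zy.
Qed.

Lemma pot0_state k t x : k.2 < t -> pot (Some k) t x = 0 ->
  (state (Some k) t x - u0) ^+ 2 = c ^+ 2.
Proof.
move=> kt; rewrite (wave_pot_state _ _ _ beta0)// => /eqP.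
rewrite mulf_eq0 mulf_eq0 (gt_eqF) ?mulr_gt0 ?subr_gt0//=.
by rewrite ?invr_eq0 ?pnatr_eq0/= ?subr_eq0// => /eqP.
Qed.

Lemma state_pot0 k t x e : e ^+ 2 = 1 -> k.2 < t ->
  state (Some k) t x = u0 + e * c -> pot (Some k) t x = 0.
Proof.
move=> e1 kt; rewrite (wave_pot_state _ _ _ beta0)// => ->.
by rewrite addrAC subrr add0r exprMn e1 mul1r subrr mulr0.
Qed.

Lemma amplitude_left w : (w - u0) ^+ 2 = c ^+ 2 -> u0 <= w -> w = u0 + c.
Proof.
move=> /eqP; rewrite eqf_sqr => /orP[] /eqP E uw; first by lra.
by have := c0; lra.
Qed.

Lemma amplitude_right w : (w - u0) ^+ 2 = c ^+ 2 -> w <= u0 -> w = u0 - c.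
Proof.
move=> /eqP; rewrite eqf_sqr => /orP[] /eqP E uw; last by lra.
by have := c0; lra.
Qed.

Lemma jump_left i t : a < t < b -> ~~ th i -> th (i - 1) ->
  derive1 (y i) t * (v i t (y i t) - u0) = g (v i t (y i t)) - f u0 /\
  u0 < v i t (y i t).
Proof.
move=> tI thi thl; have := slab_RH S i tI; have := fs_upward S i tI.
by rewrite (slab_left_f S tI thl) (negbTE thi) thl.
Qed.

Lemma jump_right i t : a < t < b -> ~~ th i -> th (i + 1) ->
  derive1 (y (i + 1)) t * (v i t (y (i + 1) t) - u0) =
    g (v i t (y (i + 1) t)) - f u0 /\ v i t (y (i + 1) t) < u0.
Proof.
move=> tI thi thr; have := slab_RH S (i + 1) tI.
have := fs_upward S (i + 1) tI.
rewrite addrK (slab_right_f S tI thr) (negbTE thi) thr /= => -> E.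
by split=> //; lra.
Qed.

Lemma closed_formula i k t x : a <= t <= b -> y i t < y (i + 1) t ->
  (forall z, y i t < z < y (i + 1) t -> v i t z = state k t z) ->
  y i t <= x <= y (i + 1) t -> v i t x = state k t x.
Proof.
move=> tI yy H; apply: (within_eq yy (slab_v_within S tI yy)) => //.
exact: wave_state_continuous.
Qed.

(* As u is bounded, the potential along the two jumps emitted from a spike is
   O(t - a); it is also constant. *)
Lemma spiked_pot i j d : spiked i -> a < d < b ->
  (forall t x, a < t <= d -> y i t < x < y (i + 1) t ->
    u t x = state (Some (y i a, a)) t x) ->
  (forall t, a < t < b -> y i t <= y j t <= y (i + 1) t) ->
  (forall t, a < t < b -> derive1 (y j) t * (v i t (y j t) - u0) =
    g (v i t (y j t)) - f u0) ->
  forall t, a < t <= d -> pot (Some (y i a, a)) t (y j t) = 0.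
Proof.
move=> sp dI H yj RH t tI; set k := (y i a, a).
have ad t' : a < t' <= d -> a < t' < b.
  by move=> /andP[-> /le_lt_trans]; apply; case/andP: dI.
have vE t' : a < t' <= d -> v i t' (y j t') = state (Some k) t' (y j t').
  move=> t'I; have t'b := ad t' t'I.
  apply: (closed_formula (k := Some k)) (yj t' t'b).
  - exact: oo_cc.
  - exact: (slab_lt S i t'b).
  - move=> z zI; rewrite -H//.
    by have [-> _] := fs_state S (oo_cc t'b) zI.
pose r s := pot (Some k) s (y j s).
(* The f-side has potential 0, so the derivative along the jump is the Rankine-Hugoniot defect
   itself. *)
have rc s s' : a < s -> s <= s' -> s' <= d -> r s' = r s.
  move=> a_s ss' s'd; apply: deriv0_eq => //.
    apply: within_wave_pot => //; first by move=> _ [<-].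
    apply: (within_subitv (ltW a_s) _ (slab_cont (i := j) S)).
    by apply: (le_trans s'd); case/andP: dI => _ /ltW.
  move=> z /andP[z1 z2].
  have zI : a < z <= d.
    by rewrite (lt_trans a_s z1) (le_trans (ltW z2)).
  have kz k' : Some k = Some k' -> k'.2 < z by move=> [<-]; case/andP: zI.
  have := is_derive_wave_pot beta0 gE cE kz (slab_speed S j (ad z zI)).
  move=> dr; apply: (is_derive_eq dr).
  rewrite -(vE z zI) /= mulNr mulrC RH ?ad//; ring.
have [M HM] := fs_bounded S.
(* By [wave_pot_state] the potential is beta (s - a)/2 times a quantity controlled by the bound on
   u. *)
pose C := beta / 2 * ((`|M| + `|u0|) ^+ 2 + c ^+ 2).
have rM s : a < s <= d -> `|r s| <= C * (s - a).
  move=> sI; have sb := ad s sI; have yy := slab_lt S i sb.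
  have yjI := yj s sb.
  have as0 : 0 < s - a by rewrite subr_gt0; case/andP: sI.
  rewrite /r (wave_pot_state _ _ _ beta0); last by case/andP: sI.
  rewrite -vE// /=; set w := v i s _.
  have wM : `|w| <= `|M|.
    have vb z : y i s < z < y (i + 1) s -> `|v i s z| <= `|M|.
      move=> zI; have [<- _] := fs_state S (oo_cc sb) zI.
      by apply: (le_trans (HM i s z (oo_cc sb) zI)); exact: ler_norm.
    rewrite ler_norml; apply/andP; split.
      apply: (within_le yy (h := fun=> - `|M|)) yjI; first exact: within_cst.
        exact: (slab_v_within S (oo_cc sb) yy).
      by move=> z /vb; rewrite ler_norml => /andP[].
    apply: (within_le yy (k := fun=> `|M|)) yjI.
    - exact: (slab_v_within S (oo_cc sb) yy).
    - exact: within_cst.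
    - by move=> z /vb; rewrite ler_norml => /andP[].
  have w2 : (w - u0) ^+ 2 <= (`|M| + `|u0|) ^+ 2.
    rewrite -real_normK ?num_real// ler_pXn2r ?nnegrE ?addr_ge0//.
    by apply: (le_trans (ler_normB _ _)); rewrite lerD2r.
  rewrite normrM ger0_norm; last by rewrite divr_ge0 ?mulr_ge0// ltW.
  have -> : C * (s - a) = beta * (s - a) / 2 * ((`|M| + `|u0|) ^+ 2 + c ^+ 2).
    by rewrite /C; ring.
  apply: ler_wpM2l; first by rewrite divr_ge0 ?mulr_ge0// ltW.
  have := sqr_ge0 (w - u0); have := sqr_ge0 c => ? ?.
  by rewrite ler_norml; apply/andP; split; lra.
have [//|n0] := eqVneq (r t) 0.
have C0 : 0 < C.
  rewrite /C mulr_gt0 ?divr_gt0// ltr_wpDl ?sqr_ge0//.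
  by rewrite exprn_gt0.
have e0 : 0 < `|r t| / (2 * C).
  by apply: divr_gt0; [rewrite normr_gt0|exact: mulr_gt0].
case/andP: (tI) => t1 t2.
(* At time a + m the bound C m is at most half of |r t|, although r takes the same value at both
   times. *)
pose m := Num.min (`|r t| / (2 * C)) (t - a).
have m0 : 0 < m by rewrite lt_min e0 subr_gt0.
have m1 : m <= `|r t| / (2 * C) by rewrite ge_min lexx.
have m2 : m <= t - a by rewrite ge_min lexx orbT.
have rt : r t = r (a + m) by apply: rc => //; lra.
have : `|r (a + m)| <= C * m.
  by have := rM (a + m); rewrite addrAC subrr add0r; apply; apply/andP; split; lra.
rewrite -rt => h; have : C * m <= `|r t| / 2.
  apply: (@le_trans _ _ (C * (`|r t| / (2 * C)))); first by rewrite ler_wpM2l// ltW.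
  by rewrite le_eqVlt; apply/orP; left; apply/eqP; field; rewrite gt_eqF.
by have : 0 < `|r t| by [rewrite normr_gt0]; lra.
Qed.

(** Initial data for [slab_evolution]: an open piece starts at t0 = a, a spike at some t0 > a, past
    its singular apex. Next to an f-piece the vanishing potential gives |u - u0| = c, and the upward
    jump selects the sign. *)
Lemma slab_start i k t1 : ~~ th i -> Kp i = Some k -> a < t1 < b ->
  exists2 t0, a <= t0 <= t1 &
  [/\ y i t0 < y (i + 1) t0 /\ k.2 < t0,
      forall x, y i t0 < x < y (i + 1) t0 -> v i t0 x = state (Some k) t0 x,
      th (i - 1) -> v i t0 (y i t0) = u0 + c
    & th (i + 1) -> v i t0 (y (i + 1) t0) = u0 - c].
Proof.
move=> thi kE t1I.
have [sp|nsp] := boolP (spiked i).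
  have {}kE : k = (y i a, a).
    by move: sp kE; rewrite /spiked /slab_wave => /negbTE -> [].
  have [d dI H] := spiked_formula sp.
  pose t0 := Num.min t1 d.
  have t01 : t0 <= t1 by rewrite ge_min lexx.
  have t0d : t0 <= d by rewrite ge_min lexx orbT.
  have at0 : a < t0 by rewrite lt_min; case/andP: t1I => ->; case/andP: dI => ->.
  have t0I : a < t0 < b by rewrite at0 (le_lt_trans t01)//; case/andP: t1I.
  have yy := slab_lt S i t0I.
  have form x : y i t0 < x < y (i + 1) t0 -> v i t0 x = state (Some k) t0 x.
    move=> xI; have [<- _] := fs_state S (oo_cc t0I) xI.
    by rewrite H ?kE// at0.
  have inl t : a < t < b -> y i t <= y i t <= y (i + 1) t.
    by move=> /(slab_lt S i)/ltW ->; rewrite lexx.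
  have inr t : a < t < b -> y i t <= y (i + 1) t <= y (i + 1) t.
    by move=> /(slab_lt S i)/ltW ->; rewrite lexx.
  have kt0 : k.2 < t0 by rewrite kE.
  exists t0; first by rewrite ltW.
  split=> //.
  - move=> thl; apply: amplitude_left; last first.
      by have [_ /ltW] := jump_left t0I thi thl.
    rewrite (closed_formula (k := Some k) (oo_cc t0I) yy form (inl _ t0I)).
    apply: pot0_state => //; rewrite kE.
    apply: (spiked_pot sp dI H inl); last by rewrite at0.
    by move=> t tI; have [] := jump_left tI thi thl.
  - move=> thr; apply: amplitude_right; last first.
      by have [_ /ltW] := jump_right t0I thi thr.
    rewrite (closed_formula (k := Some k) (oo_cc t0I) yy form (inr _ t0I)).
    apply: pot0_state => //; rewrite kE.
    apply: (spiked_pot sp dI H inr); last by rewrite at0.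
    by move=> t tI; have [] := jump_right tI thi thr.
have yy : y i a < y (i + 1) a by exact: negPn nsp.
have ka := unspiked_time nsp kE.
have form x : y i a < x < y (i + 1) a -> v i a x = state (Some k) a x.
  move=> xI; have [<- _] := fs_state S acc xI.
  have [-> _] := wp_state Pr (start_no_jump xI).
  by rewrite (slab_waveE xI) kE.
have at1 : a <= t1 by case/andP: t1I => /ltW.
have cont (j : int) : (forall t, a <= t <= b -> y i t <= y j t <= y (i + 1) t) ->
    {within `[a, t1], continuous (fun t => v i t (y j t))}.
  move=> yj; apply: within_comp.
    apply: (within_subitv (lexx a) _ (slab_cont (i := j) S)).
    by case/andP: t1I => _ /ltW.
  move=> t /andP[a_t tt1]; have tb : t < b by rewrite (le_lt_trans tt1)//; case/andP: t1I.
  have tI : a <= t <= b by rewrite a_t ltW.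
  apply: frechet_continuous (C1_at_frechet (slab_C1 S tI _ (yj t tI))).
  move: a_t; rewrite le_eqVlt => /predU1P[<-//|a_t].
  by apply: (slab_lt S i); rewrite a_t.
have inl t : a <= t <= b -> y i t <= y i t <= y (i + 1) t.
  by move=> /(slab_le ab S i) ->; rewrite lexx.
have inr t : a <= t <= b -> y i t <= y (i + 1) t <= y (i + 1) t.
  by move=> /(slab_le ab S i) ->; rewrite lexx.
have oo t : a < t < t1 -> a < t < b.
  by move=> /andP[-> /lt_trans]; apply; case/andP: t1I.
exists a; first by rewrite lexx.
split=> //.
- move=> thl.
  have nspl : ~~ spiked (i - 1).
    apply/negP => sp; move: thl; rewrite slab_thE.
    by rewrite /slab_wave (negbTE sp).
  apply: amplitude_left.
    rewrite (closed_formula (k := Some k) acc yy form (inl _ acc)).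
    apply: pot0_state => //; rewrite -kE -unspiked_match//.
    by move: thl; rewrite slab_thE; case: (Kp (i - 1)).
  (* The sign of the jump is known for t > a; at a it follows by continuity of the trace. *)
  apply: (within_le (h := fun=> u0) (k := fun t => v i t (y i t)) (a := a) (b := t1)).
  - by case/andP: t1I.
  - exact: within_cst.
  - exact: cont.
  - by move=> t /oo tI; have [_ /ltW] := jump_left tI thi thl.
  - by rewrite lexx.
- move=> thr.
  have nspr : ~~ spiked (i + 1).
    apply/negP => sp; move: thr; rewrite slab_thE.
    by rewrite /slab_wave (negbTE sp).
  apply: amplitude_right.
    rewrite (closed_formula (k := Some k) acc yy form (inr _ acc)).
    apply: pot0_state => //; rewrite -kE.
    have := @unspiked_match (i + 1); rewrite addrK => -> //.
    by move: thr; rewrite slab_thE; case: (Kp (i + 1)).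
  apply: (within_le (k := fun=> u0) (h := fun t => v i t (y (i + 1) t)) (a := a) (b := t1)).
  - by case/andP: t1I.
  - exact: cont.
  - exact: within_cst.
  - by move=> t /oo tI; have [_ /ltW] := jump_right tI thi thr.
  - by rewrite lexx.
Qed.

Lemma slab_formula i k t : ~~ th i -> Kp i = Some k -> a < t < b ->
  [/\ forall x, y i t <= x <= y (i + 1) t -> v i t x = state (Some k) t x,
      th (i - 1) -> v i t (y i t) = u0 + c
    & th (i + 1) -> v i t (y (i + 1) t) = u0 - c].
Proof.
move=> thi kE tI.
have [t0 /andP[at0 t0t] [[yy kt0] form l r]] := slab_start thi kE tI.
have tb : t < b by case/andP: tI.
have H := slab_evolution beta0 c0 gE cE S at0 t0t tb yy thi kt0 form l r.
by apply: (H t); rewrite t0t lexx.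
Qed.

Lemma slab_state i t x : a < t < b -> y i t <= x <= y (i + 1) t ->
  v i t x = state (Kp i) t x.
Proof.
move=> tI xI; have := slab_thE i; case kE: (Kp i) => [k|] /= thE.
  by have [|H _ _] := slab_formula _ kE tI; [rewrite thE|exact: H].
by apply: (slab_f S) (oo_cc tI) _ xI; [rewrite thE|exact: (slab_lt S i tI)].
Qed.

Lemma wave_flux i : flux f g (th i) = flux f g (~~ isSome (Kp i)).
Proof. by rewrite slab_thE. Qed.

Lemma slab_time i s k : a < s -> Kp i = Some k -> k.2 < s.
Proof. by move=> a_s /slab_wave_time/le_lt_trans; apply. Qed.

(** The time derivative of this difference is the Rankine-Hugoniot defect. The start s may be later
    than a, since a wave emitted at a has a singular potential there. *)
Lemma slab_pot_diff i s t : a <= s -> s <= t -> t <= b ->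
  (forall k, Kp (i - 1) = Some k -> k.2 < s) ->
  (forall k, Kp i = Some k -> k.2 < s) ->
  pot (Kp (i - 1)) t (y i t) - pot (Kp i) t (y i t) =
  pot (Kp (i - 1)) s (y i s) - pot (Kp i) s (y i s).
Proof.
move=> a_s st tb kl kr.
have cy := within_subitv a_s tb (slab_cont (i := i) S).
pose D z := pot (Kp (i - 1)) z (y i z) - pot (Kp i) z (y i z).
apply: (deriv0_eq (h := D) st).
  by apply: within_sub; exact: within_wave_pot.
move=> z /andP[sz zt]; have zI : a < z < b.
  by rewrite (le_lt_trans a_s sz) (lt_le_trans zt tb).
have dy := slab_speed S i zI.
have dl := is_derive_wave_pot beta0 gE cE
  (fun k kE => lt_trans (kl k kE) sz) dy.
have dr := is_derive_wave_pot beta0 gE cE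
  (fun k kE => lt_trans (kr k kE) sz) dy.
apply: (is_derive_eq (is_deriveB dl dr)).
have lI : y (i - 1) z <= y i z <= y (i - 1 + 1) z.
  by rewrite subrK lexx andbT; have := slab_le ab S (i - 1) (oo_cc zI); rewrite subrK.
have rI : y i z <= y i z <= y (i + 1) z.
  by rewrite lexx (slab_le ab S i (oo_cc zI)).
rewrite -(slab_state zI lI) -(slab_state zI rI).
have := slab_RH S i zI; rewrite !wave_flux.
set w := v i z _; set w' := v _ z _ => RH.
by lra.
Qed.

Lemma slab_match i t : a < t <= b ->
  pot (Kp (i - 1)) t (y i t) = pot (Kp i) t (y i t).
Proof.
move=> /andP[a_t tb]; apply/eqP; rewrite -subr_eq0; apply/eqP.
(* If both pieces carry g, neither is a new spike, whose neighbours are f-pieces; the equality is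
   inherited from time a. *)
have [sl|] := boolP (th (i - 1) || th i); last first.
  rewrite !slab_thE negb_or !negbK => /andP[sl sr].
  have nl : ~~ spiked (i - 1).
    by apply: contraL sr => /spiked_right; rewrite subrK => ->.
  have nr : ~~ spiked i by apply: contraL sl => /spiked_left ->.
  have kl k : Kp (i - 1) = Some k -> k.2 < a by exact: unspiked_time.
  have kr k : Kp i = Some k -> k.2 < a by exact: unspiked_time.
  rewrite (slab_pot_diff (lexx a) (ltW a_t) tb kl kr).
  by rewrite unspiked_match// subrr.
(* Next to an f-piece the g-trace is u0 + c or u0 - c, so both potentials vanish at [s], a time past
   a possible apex at a. *)
pose s := (a + t) / 2.
have a_s : a < s by rewrite /s midf_lt.
have st : s < t by rewrite /s midf_lt.
have sI : a < s < b by rewrite a_s (lt_le_trans st).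
rewrite (slab_pot_diff (ltW a_s) (ltW st) tb
  (fun k => slab_time a_s) (fun k => slab_time a_s)).
have [thi|thi] := boolP (th i).
  have thl := slab_f_isolated ab S thi.
  have := slab_thE (i - 1); rewrite (negbTE thl).
  case kE: (Kp (i - 1)) => [k|//] _.
  have KN : Kp i = None by have := slab_thE i; rewrite thi; case: (Kp i).
  have [H _] := slab_formula thl kE sI; rewrite subrK => /(_ thi) E.
  rewrite KN [X in _ - X]/= subr0; apply: (@state_pot0 _ _ _ (-1)).
  - by rewrite sqrrN expr1n.
  - exact: slab_time kE.
  - rewrite mulN1r -E H// subrK lexx andbT.
    by have := slab_le ab S (i - 1) (oo_cc sI); rewrite subrK.
have thl : th (i - 1) by rewrite (negbTE thi) orbF in sl.
have := slab_thE i; rewrite (negbTE thi); case kE: (Kp i) => [k|//] _.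
have KN : Kp (i - 1) = None.
  by have := slab_thE (i - 1); rewrite thl; case: (Kp (i - 1)).
have [H E _] := slab_formula thi kE sI.
rewrite KN [X in X - _]/= sub0r; apply/eqP; rewrite oppr_eq0; apply/eqP.
apply: (@state_pot0 _ _ _ 1).
- by rewrite expr1n.
- exact: slab_time kE.
- by rewrite mul1r -E// H// lexx (slab_le ab S i (oo_cc sI)).
Qed.

Lemma slab_upward i t : a < t <= b ->
  state (Kp (i - 1)) t (y i t) <= state (Kp i) t (y i t).
Proof.
move=> /andP[a_t tb]; pose s := (a + t) / 2.
have a_s : a < s by rewrite /s midf_lt.
have st : s < t by rewrite /s midf_lt.
have cy := within_subitv (ltW a_s) tb (slab_cont (i := i) S).
apply: (within_le st (h := fun t => state (Kp (i - 1)) t (y i t))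
  (k := fun t => state (Kp i) t (y i t))).
- by apply: within_wave_state => // k; exact: slab_time.
- by apply: within_wave_state => // k; exact: slab_time.
- move=> z /andP[sz zt]; have zI : a < z < b.
    by rewrite (lt_trans a_s sz) (lt_le_trans zt tb).
  have lI : y (i - 1) z <= y i z <= y (i - 1 + 1) z.
    by rewrite subrK lexx andbT; have := slab_le ab S (i - 1) (oo_cc zI); rewrite subrK.
  have rI : y i z <= y i z <= y (i + 1) z.
    by rewrite lexx (slab_le ab S i (oo_cc zI)).
  rewrite -(slab_state zI lI) -(slab_state zI rI).
  exact: ltW (fs_upward S i zI).
- by rewrite (ltW st) lexx.
Qed.

Lemma slab_u i t x : a < t <= b -> y i t < x < y (i + 1) t ->
  u t x = state (Kp i) t x.
Proof.
move=> /andP[a_t]; rewrite le_eqVlt => /predU1P[->|tb] xI; last first.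
  have tI : a < t < b by rewrite a_t.
  have [-> _] := fs_state S (oo_cc tI) xI.
  by apply: slab_state => //; case/andP: xI => /ltW -> /ltW ->.
have bb : a <= b <= b by rewrite lexx ltW.
have [-> _] := fs_state S bb xI.
case/andP: xI => x1 x2.
have e1 : 0 < (x - y i b) / 2 by rewrite divr_gt0// subr_gt0.
have e2 : 0 < (y (i + 1) b - x) / 2 by rewrite divr_gt0// subr_gt0.
have [d1 d10 H1] := within_itvP (slab_cont (i := i) S) bb e1.
have [d2 d20 H2] := within_itvP (slab_cont (i := i + 1) S) bb e2.
(* On [b - m, b] each of the two jumps stays within half of its final distance to x, so x remains
   inside the piece and the formula passes to the limit t = b. *)
pose m := Num.min (Num.min d1 d2) (b - a) / 2.
have m0 : 0 < m by rewrite divr_gt0// !lt_min d10 d20 subr_gt0.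
have m1 : m < d1 /\ m < d2 /\ m < b - a.
  have : m < Num.min (Num.min d1 d2) (b - a).
    by rewrite /m ltr_pdivrMr// ltr_pMr ?ltr1n// !lt_min d10 d20 subr_gt0.
  by rewrite !lt_min => /andP[/andP[]].
case: m1 => md1 [md2 mba].
have a_s : a < b - m by lra.
have sb : b - m < b by lra.
have inx z : b - m <= z <= b -> y i z <= x <= y (i + 1) z /\ y i z < y (i + 1) z.
  move=> /andP[z1 z2]; have zI : a <= z <= b by apply/andP; split; lra.
  have zd : `|z - b| <= m by rewrite ler_norml; apply/andP; split; lra.
  have := H1 z zI (le_lt_trans zd md1); have := H2 z zI (le_lt_trans zd md2).
  rewrite !ler_norml => /andP[? ?] /andP[? ?].
  by split; [apply/andP; split|]; lra.
apply: (within_eq sb (h := v i ^~ x) (k := fun t => state (Kp i) t x)).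
- apply: (within_comp (h := fun=> x)); first exact: within_cst.
  move=> z zI; have [xI' yy] := inx z zI.
  have zab : a <= z <= b by case/andP: zI => z1 ->; rewrite (ltW (lt_le_trans a_s z1)).
  exact: (frechet_continuous (C1_at_frechet (slab_C1 S zab yy xI'))).
- apply: (within_wave_state (h := fun=> x)) => //; last exact: within_cst.
  by move=> k; exact: slab_time.
- move=> z /andP[z1 z2]; apply: slab_state; first by rewrite z2 (lt_trans a_s z1).
  by have [|//] := inx z; rewrite (ltW z1) ltW.
- by rewrite lexx ltW.
Qed.

(** [wp_width] concerns closed intervals without jumps, hence the piece is shortened by m at both
    ends. At a = T1 it gives no bound, but then [width a] is L and a piece fits in one period. *)
Lemma slab_width0 i : Kp i = None -> y (i + 1) a - y i a <= width a.
Proof.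
move=> KN; have yy : y i a < y (i + 1) a.
  by move: KN; rewrite /slab_wave; case: ifP.
rewrite leNgt; apply/negP => H.
set w := y (i + 1) a - y i a in H.
have w0 : 0 < w by rewrite subr_gt0.
pose m := Num.min w (w - width a) / 4.
have m0 : 0 < m by rewrite divr_gt0// lt_min w0 subr_gt0.
have m1 : 4 * m <= w by rewrite mulrC divfK ?pnatr_eq0// ge_min lexx.
have m2 : 4 * m <= w - width a.
  by rewrite mulrC divfK ?pnatr_eq0// ge_min lexx orbT.
have xx : y i a + m <= y (i + 1) a - m by rewrite /w in m1; lra.
have nP z : y i a + m <= z <= y (i + 1) a - m -> ~ P z.
  by move=> /andP[? ?]; apply: (@start_no_jump i); apply/andP; split; lra.
have Kx : K (y i a + m) = None.
  by rewrite (slab_waveE (i := i))//; apply/andP; split; lra.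
have [aT|] := wp_width Pr xx nP Kx; last by rewrite /w in m2; lra.
have aE : a = T1 by apply/eqP; rewrite eq_le aT.
have wL : width a = L by rewrite /f_width aE subrr mulr0 subr0.
have [n n0 yn] := fs_period S.
have : y (i + 1) a <= y (i + n%:Z) a by apply: mono; rewrite // lerD2l lez_nat.
by rewrite yn// wL in H *; rewrite /w in H; lra.
Qed.

(** The outer traces are u0 - c on the left and u0 + c on the right, so the ends move at the speeds
    [speed] + beta c and [speed] - beta c. *)
Lemma slab_width i t : Kp i = None -> a < t <= b ->
  y (i + 1) t - y i t <= width t.
Proof.
move=> KN /andP[a_t tb]; have w0 := slab_width0 KN.
have thi : th i by rewrite slab_thE KN.
have thl := slab_f_isolated ab S thi.
have thr : ~~ th (i + 1).
  by apply/negP => thr; have := slab_f_isolated ab S thr; rewrite addrK thi.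
have : y (i + 1) t - y i t + 2 * beta * c * t =
       y (i + 1) a - y i a + 2 * beta * c * a.
  apply: (deriv0_eq (h := fun t => y (i + 1) t - y i t + 2 * beta * c * t) (ltW a_t)).
    apply: within_add; last by apply: within_mul; [exact: within_cst|exact: within_id].
    apply: within_sub.
    - exact: (within_subitv (lexx a) tb (slab_cont (i := i + 1) S)).
    - exact: (within_subitv (lexx a) tb (slab_cont (i := i) S)).
  move=> z /andP[az zt]; have zI : a < z < b by rewrite az (lt_le_trans zt).
  have yl : derive1 (y i) z = speed + beta * c.
    have := slab_thE (i - 1); rewrite (negbTE thl).
    case kE: (Kp (i - 1)) => [k|//] _.
    have [_ _] := slab_formula thl kE zI; rewrite subrK => /(_ thi) E.
    have [|] := jump_right zI thl; first by rewrite subrK.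
    rewrite subrK E => RH _.
    apply: (mulIf (lt0r_neq0 c0)).
    have -> : derive1 (y i) z * c = - (derive1 (y i) z * (u0 - c - u0)) by ring.
    by rewrite RH cE !gE; field.
  have yr : derive1 (y (i + 1)) z = speed - beta * c.
    have := slab_thE (i + 1); rewrite (negbTE thr).
    case kE: (Kp (i + 1)) => [k|//] _.
    have [_] := slab_formula thr kE zI; rewrite addrK => /(_ thi) E _.
    have [|] := jump_left zI thr; first by rewrite addrK.
    rewrite E => RH _.
    apply: (mulIf (lt0r_neq0 c0)).
    have -> : derive1 (y (i + 1)) z * c =
      derive1 (y (i + 1)) z * (u0 + c - u0) by ring.
    by rewrite RH cE !gE; field.
  have dl := slab_speed S i zI; have dr := slab_speed S (i + 1) zI.
  rewrite yl in dl; rewrite yr in dr.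
  by apply: is_derive_eq; rewrite /GRing.scale/=; ring.
rewrite /f_width in w0 *.
have -> : 2 * beta * c * (t - T1) = 2 * beta * c * t - 2 * beta * c * T1 by ring.
have E : 2 * beta * c * (a - T1) = 2 * beta * c * a - 2 * beta * c * T1 by ring.
by rewrite E in w0; lra.
Qed.

Lemma width_ge0_end t : 0 <= width t -> t <= Tend.
Proof.
have bc : 0 < 2 * beta * c by rewrite !mulr_gt0.
rewrite /f_width /f_end subr_ge0 mulrC -ler_pdivlMr// => ?; lra.
Qed.

(** A spike inserted at a has an adjacent f-piece of positive length, at most [width a]; this is
    impossible after [Tend]. *)
Lemma slab_wave_Tend i k : Kp i = Some k -> k.2 <= a /\ k.2 <= Tend.
Proof.
move=> kE; split; first exact: slab_wave_time kE.
have [sp|nsp] := boolP (spiked i).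
  have := slab_width0 (spiked_left sp); rewrite subrK.
  have [_ _ lt1 _] := spikedP sp.
  have -> : k.2 = a by move: kE sp; rewrite /spiked /slab_wave; case: ifP => // _ [<-].
  move=> w; apply: width_ge0_end; apply: le_trans w.
  by rewrite subr_ge0 ltW.
have yy : y i a < y (i + 1) a by exact: negPn nsp.
move: kE; rewrite /slab_wave yy => kE.
by have [] := wp_time Pr (start_no_jump (mid_in yy)) kE.
Qed.

Lemma slab_wavesP : slab_waves alpha beta L u0 c T1 u a b y th Kp.
Proof.
split.
- exact: slab_thE.
- exact: slab_wave_Tend.
- exact: slab_u.
- exact: slab_match.
- exact: slab_upward.
- exact: slab_width.
Qed.

End step.

(** * From the waves on ]a, b] to the profile at b *)

Section next.
Variables (R : realType) (f g : R -> R) (alpha beta L u0 c T1 : R).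
Hypothesis L0 : 0 < L.
Variables (u : R -> R -> R) (theta : R -> R -> bool) (a b : R).
Variables (y : int -> R -> R) (v : int -> R -> R -> R) (th : int -> bool).
Variable (Kp : int -> option (R * R)).
Hypothesis ab : a < b.
Hypothesis S : front_slab f g L u0 u theta a b y v th.
Hypothesis W : slab_waves alpha beta L u0 c T1 u a b y th Kp.

Lemma next_profile :
  exists K, wave_profile alpha beta L u0 c T1 u theta b (range (y ^~ b)) K.
Proof.
have bb : a <= b <= b by rewrite lexx ltW.
have abb : a < b <= b by rewrite lexx ab.
(* The strict upper bound ensures that a piece closed at b is never selected. *)
have [idx idxP] : {idx : R -> int | forall x, y (idx x) b <= x < y (idx x + 1) b}.
  exists (fun x => projT1 (cid (slab_locate L0 S x bb))) => x.
  by case: cid.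
have mono i j : i <= j -> y i b <= y j b by move=> ij; exact: (slab_mono ab S bb ij).
have inr i : range (y ^~ b) (y i b) by exists i.
have open x : ~ range (y ^~ b) x -> y (idx x) b < x < y (idx x + 1) b.
  move=> nx; have /andP[x1 ->] := idxP x; rewrite andbT lt_neqAle x1 andbT.
  by apply/eqP => E; apply: nx; rewrite -E.
have same x x' : x <= x' -> (forall z, x <= z <= x' -> ~ range (y ^~ b) z) ->
    idx x' = idx x.
  move=> xx nP; have /andP[l1 l2] := idxP x; have /andP[r1 r2] := idxP x'.
  apply/eqP; rewrite eq_le; apply/andP; split; rewrite leNgt; apply/negP => lt1.
  - have H : y (idx x + 1) b <= y (idx x') b by apply: mono; rewrite lezD1.
    apply: (nP (y (idx x') b)) => //; rewrite r1 andbT; lra.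
  - have H : y (idx x' + 1) b <= y (idx x) b by apply: mono; rewrite lezD1.
    lra.
exists (Kp \o idx); split.
- have [n n0 yn] := fs_period S.
  move=> x; split=> -[i _ /= ix].
    by exists (i + n%:Z) => //=; rewrite yn// ix.
  exists (i - n%:Z) => //=; have := yn (i - n%:Z) b bb; rewrite subrK ix.
  by move/addIr.
- move=> x /open xI; split; first exact: (sw_state W).
  by have [_ ->] := fs_state S bb xI; rewrite (sw_th W).
- move=> x k _ /= /(sw_time W)[ka ->]; split=> //.
  exact: le_lt_trans ab.
- by move=> x x' xx /(same _ _ xx) /= ->.
- move=> p x x' /andP[xp px'] nP /=.
  have /andP[l1 l2] := idxP x; have /andP[r1 r2] := idxP x'.
  (* When several jumps meet at p, the equality of potentials is chained through all the pieces
     closed at p. *)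
  have key (n : nat) : (forall m : int, idx x < m -> m <= idx x + n%:Z -> y m b = p) ->
      wave_pot alpha beta u0 c (Kp (idx x)) b p =
      wave_pot alpha beta u0 c (Kp (idx x + n%:Z)) b p.
    elim: n => [|n IH] H; first by rewrite addr0.
    rewrite IH; last first.
      by move=> m m1 m2; rewrite H// (le_trans m2)// lerD2l lez_nat.
    have := sw_match W (idx x + n.+1%:Z) abb.
    by rewrite (H (idx x + n.+1%:Z))// ?ltrDl// int_addS addrK.
  have ii : idx x <= idx x'.
    rewrite leNgt; apply/negP => lt1.
    have H : y (idx x' + 1) b <= y (idx x) b by apply: mono; rewrite lezD1.
    lra.
  have [k kE] := int_le_add ii.
  rewrite kE; apply: key => m m1 m2; apply/eqP/negP => /negP mp.
  have h1 : y (idx x + 1) b <= y m b by apply: mono; rewrite lezD1.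
  have h2 : y m b <= y (idx x') b by apply: mono; rewrite kE.
  by apply: (nP (y m b)) mp (inr m); apply/andP; split; lra.
- move=> x x' xx nP /= KN; right.
  have := sw_width W KN abb; apply: le_trans.
  have /andP[l1 l2] := idxP x; have /andP[r1 r2] := idxP x'.
  by rewrite (same _ _ xx nP) in r1 r2; lra.
Qed.

End next.

(* Where D < - L M, it stays negative over a whole period to the right: along
   the pieces D grows at most at the rate M, and it jumps downwards. So the
   primitive q of D would decrease over a period. *)
Lemma sawtooth_lower {R : realType} (y : int -> R) (q D : int -> R -> R)
    (m : int -> R) (M L : R) (n : nat) :
  0 < L -> 0 <= M -> (forall i, y i <= y (i + 1)) ->
  (forall i, y (i + n%:Z) = y i + L) -> (forall i, m i <= M) ->
  (forall i x x', D i x' = D i x + m i * (x' - x)) ->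
  (forall i x x', q i x' - q i x = (D i x + D i x') / 2 * (x' - x)) ->
  (forall i, q i (y (i + 1)) = q (i + 1) (y (i + 1))) ->
  (forall i, D (i + 1) (y (i + 1)) <= D i (y (i + 1))) ->
  (forall i x, q (i + n%:Z) (x + L) = q i x) ->
  forall i x, y i <= x <= y (i + 1) -> - (L * M) <= D i x.
Proof.
move=> L0 M0 yS yn mM DE qE qm Dm qn i x0 /andP[yx xy].
rewrite leNgt; apply/negP => DL.
(* Up to x0 + L the bound D <= D i x0 + M (x - x0) gives D <= - k, so q decreases at least at the
   rate k. *)
pose k := - (D i x0 + L * M).
have k0 : 0 < k by rewrite /k; lra.
have on_piece (j : int) x1 x : x0 <= x1 -> x1 <= x -> x <= x0 + L ->
    D j x1 <= D i x0 + M * (x1 - x0) -> q j x1 <= q i x0 - k * (x1 - x0) ->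
    D j x <= D i x0 + M * (x - x0) /\ q j x <= q i x0 - k * (x - x0).
  move=> x01 x1x xL D1 q1.
  have M1 : m j * (x - x1) <= M * (x - x1) by rewrite ler_wpM2r ?subr_ge0.
  have D2 : D j x <= D i x0 + M * (x - x0).
    by rewrite (DE j x1); have : M * (x - x0) = M * (x1 - x0) + M * (x - x1) by [ring]; lra.
  split=> //.
  have slope z : x0 <= z -> z <= x0 + L -> D i x0 + M * (z - x0) <= - k.
    move=> z1 z2; have : M * (z - x0) <= M * L by apply: ler_wpM2l => //; lra.
    rewrite /k mulrC; lra.
  have s1 := slope x1 x01 (le_trans x1x xL).
  have s2 := slope x (le_trans x01 x1x) xL.
  have := qE j x1 x.
  have : (D j x1 + D j x) / 2 * (x - x1) <= - k * (x - x1).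
    by apply: ler_wpM2r; rewrite ?subr_ge0//; lra.
  have : k * (x - x0) = k * (x1 - x0) + k * (x - x1) by ring.
  rewrite mulNr; lra.
have main (j : nat) x : y (i + j%:Z) <= x <= y (i + j%:Z + 1) -> x0 <= x ->
    x <= x0 + L ->
    D (i + j%:Z) x <= D i x0 + M * (x - x0) /\
    q (i + j%:Z) x <= q i x0 - k * (x - x0).
  elim: j x => [|j IH] x /andP[x1 x2] x3 x4.
    rewrite addr0; apply: (@on_piece _ x0) => //; rewrite ?subrr ?mulr0 ?addr0 ?subr0//.
  have jE := int_addS i j.
  rewrite jE in x1 x2 *.
  have yi : x0 <= y (i + j%:Z + 1).
    by apply: (le_trans xy); apply: (int_nondecreasing yS); rewrite lerD2r lerDl.
  have [|||D1 q1] := IH (y (i + j%:Z + 1)); rewrite ?lexx ?yS ?andbT//; first lra.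
  apply: (@on_piece _ (y (i + j%:Z + 1))) => //.
    exact: le_trans (Dm _) D1.
  by rewrite -qm.
(* Piece i + n at x0 + L is the translate of piece i at x0, so q has the same value at both. *)
have [|||_] := main n (x0 + L).
- rewrite (addrAC i n%:Z 1).
  by rewrite !yn !lerD2r yx.
- by rewrite lerDl ltW.
- by [].
rewrite qn [x0 + L]addrC addrK => ?.
have : 0 < k * L by rewrite mulr_gt0.
lra.
Qed.

(** Reflection of [sawtooth_lower]: x becomes - x, D becomes - D and piece j becomes piece - j.
    Slopes keep their sign, D still jumps downwards and q is still a primitive. The left end of the
    new piece j is minus the right end of piece - j, hence the index 1 - j. *)
Lemma sawtooth_upper {R : realType} (y : int -> R) (q D : int -> R -> R)
    (m : int -> R) (M L : R) (n : nat) :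
  0 < L -> 0 <= M -> (forall i, y i <= y (i + 1)) ->
  (forall i, y (i + n%:Z) = y i + L) -> (forall i, m i <= M) ->
  (forall i x x', D i x' = D i x + m i * (x' - x)) ->
  (forall i x x', q i x' - q i x = (D i x + D i x') / 2 * (x' - x)) ->
  (forall i, q i (y (i + 1)) = q (i + 1) (y (i + 1))) ->
  (forall i, D (i + 1) (y (i + 1)) <= D i (y (i + 1))) ->
  (forall i x, q (i + n%:Z) (x + L) = q i x) ->
  forall i x, y i <= x <= y (i + 1) -> D i x <= L * M.
Proof.
move=> L0 M0 yS yn mM DE qE qm Dm qn i x xI.
have yR (j : int) : 1 - (j + 1) = - j by lia.
have yR' (j : int) : 1 - j = - j + 1 by lia.
have nR (j : int) : - (j + 1) + 1 = - j by lia.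
suff : - (L * M) <= (fun j z => - D (- j) (- z)) (- i) (- x).
  by rewrite !opprK lerN2.
apply: (@sawtooth_lower _ (fun j => - y (1 - j)) (fun j z => q (- j) (- z))
  (fun j z => - D (- j) (- z)) (fun j => m (- j)) M L n L0 M0).
- by move=> j; rewrite yR yR' lerN2 yS.
- move=> j; have := yn (1 - (j + n%:Z)); have -> : 1 - (j + n%:Z) + n%:Z = 1 - j by lia.
  by move=> ->; ring.
- by [].
- by move=> j z z'; rewrite (DE _ (- z)); ring.
- by move=> j z z'; rewrite qE; field.
- by move=> j; rewrite yR opprK; have := qm (- (j + 1)); rewrite nR.
- by move=> j; rewrite yR opprK lerN2; have := Dm (- (j + 1)); rewrite nR.
- move=> j z; have := qn (- (j + n%:Z)) (- (z + L)).
  by have -> : - (j + n%:Z) + n%:Z = - j by [lia]; rewrite opprD addrNK.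
- by rewrite yR yR' !opprK !lerN2 andbC.
Qed.

(** The slope determines the emission time, then one value determines the centre. This recovers the
    periodicity of the waves from that of u. *)
Lemma wave_state_inj {R : realType} (alpha beta u0 L s l r : R) (k k' : R * R) :
  0 < beta -> k.2 < s -> k'.2 < s -> l < r ->
  (forall x, l < x < r -> wave_state alpha beta u0 (Some k) s x =
     wave_state alpha beta u0 (Some k') s (x + L)) ->
  k' = (k.1 + L, k.2).
Proof.
move=> beta0 ks ks' lr H.
have b0 : beta != 0 by rewrite gt_eqF.
have d0 : s - k.2 != 0 by rewrite subr_eq0 gt_eqF.
have d0' : s - k'.2 != 0 by rewrite subr_eq0 gt_eqF.
have {}H x : l < x < r -> (x - k.1) * (s - k'.2) = (x + L - k'.1) * (s - k.2).
  move=> /H; rewrite /wave_state => /addrI/oppr_inj E.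
  have -> : (x - k.1) * (s - k'.2) =
      (x - k.1) / (beta * (s - k.2)) * (beta * (s - k.2) * (s - k'.2)).
    by field; rewrite d0 b0.
  by rewrite E; field; rewrite d0' b0.
have I2 : l < l + (r - l) / 2 < r by apply/andP; split; lra.
have I3 : l < l + (r - l) / 3 < r by apply/andP; split; lra.
have E2 := H _ I2; have E3 := H _ I3.
have rl : (r - l) / 2 - (r - l) / 3 != 0 by apply/eqP; lra.
have E : ((r - l) / 2 - (r - l) / 3) * (s - k'.2) =
    ((r - l) / 2 - (r - l) / 3) * (s - k.2).
  have : (l + (r - l) / 2 - k.1) * (s - k'.2) - (l + (r - l) / 3 - k.1) * (s - k'.2) =
    (l + (r - l) / 2 + L - k'.1) * (s - k.2) - (l + (r - l) / 3 + L - k'.1) * (s - k.2).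
    by rewrite E2 E3.
  by rewrite -!mulrBl => E; apply: etrans (etrans _ E) _; congr (_ * _); ring.
move/(mulfI rl)/addrI/oppr_inj: E => E.
rewrite E in E2; move/(mulIf d0): E2 => E2.
by rewrite [k']surjective_pairing E; congr (_, _); lra.
Qed.

(** * Uniform decay once no f-interval is left *)

Section decay.
Variables (R : realType) (f g : R -> R) (alpha beta L u0 c T1 : R).
Hypothesis beta0 : 0 < beta.
Hypothesis c0 : 0 < c.
Hypothesis L0 : 0 < L.
Variables (u : R -> R -> R) (theta : R -> R -> bool) (a b : R).
Variables (y : int -> R -> R) (v : int -> R -> R -> R) (th : int -> bool).
Variable (Kp : int -> option (R * R)).
Hypothesis ab : a < b.
Hypothesis u_per : forall t x, a <= t -> u t (x + L) = u t x.
Hypothesis S : front_slab f g L u0 u theta a b y v th.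
Hypothesis W : slab_waves alpha beta L u0 c T1 u a b y th Kp.
Local Notation Tend := (f_end beta L c T1).

Lemma slab_decay t x : a < t <= b -> Tend < t -> ~ range (y ^~ t) x ->
  `|u t x - u0| <= L * (beta * (t - Tend))^-1.
Proof.
move=> tI tT nx.
have tI' : a <= t <= b by case/andP: tI => /ltW -> ->.
have bc : 0 < 2 * beta * c by rewrite !mulr_gt0.
(* After [Tend] the width bound is negative, while the length of a piece is not. *)
have KN i : Kp i <> None.
  move=> /(sw_width W)/(_ tI); have := slab_le ab S i tI'.
  rewrite /f_width -subr_ge0 => h1 /(le_trans h1).
  rewrite subr_ge0 mulrC -ler_pdivlMr// => h2.
  by move: tT; rewrite /f_end; lra.
(* The default value is never taken, by [KN]. *)
pose kk i := odflt (0, 0) (Kp i).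
have KE i : Kp i = Some (kk i) by move: (KN i); rewrite /kk; case: (Kp i).
have kT i : (kk i).2 <= Tend by have [] := sw_time W (KE i).
have ka i : (kk i).2 <= a by have [] := sw_time W (KE i).
have kt i : 0 < t - (kk i).2 by rewrite subr_gt0 (le_lt_trans (kT i)).
have tT0 : 0 < t - Tend by rewrite subr_gt0.
have b0 : beta != 0 by rewrite gt_eqF.
have kt0 i : t - (kk i).2 != 0 by rewrite gt_eqF.
have [n n0 yn] := fs_period S.
(* The waves are compared at the middle of the slab, where every piece is open; at t = b some may be
   closed. *)
have kn i : kk (i + n%:Z) = ((kk i).1 + L, (kk i).2).
  have sI : a < (a + b) / 2 < b by rewrite !midf_lt.
  set s := (a + b) / 2 in sI.
  have as0 : a < s by case/andP: sI.
  have sI' : a < s <= b by case/andP: sI => -> /ltW.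
  apply: (wave_state_inj (alpha := alpha) (u0 := u0) beta0 _ _ (slab_lt S i sI)).
  - exact: le_lt_trans as0.
  - exact: le_lt_trans as0.
  - move=> z zI; rewrite -KE -(sw_state W sI' zI) -KE.
    rewrite -(sw_state W (i := i + n%:Z) sI') ?u_per ?(ltW as0)//.
    rewrite (addrAC i n%:Z 1).
    by rewrite !yn ?(oo_cc sI)// !ltrD2r.
pose D i z := u0 - wave_state alpha beta u0 (Some (kk i)) t z.
pose q i z := wave_pot alpha beta u0 c (Some (kk i)) t z.
pose m i := (beta * (t - (kk i).2))^-1.
have DE i z z' : D i z' = D i z + m i * (z' - z).
  by rewrite /D /m /wave_state; field; rewrite kt0 b0.
have qE i z z' : q i z' - q i z = (D i z + D i z') / 2 * (z' - z).
  by rewrite /D /q /wave_state /wave_pot; field; rewrite kt0 b0.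
have mM i : m i <= (beta * (t - Tend))^-1.
  by rewrite /m lef_pV2 ?posrE ?mulr_gt0// ler_pM2l// lerD2l lerN2.
have qm i : q i (y (i + 1) t) = q (i + 1) (y (i + 1) t).
  by have := sw_match W (i + 1) tI; rewrite addrK !KE.
have Dm i : D (i + 1) (y (i + 1) t) <= D i (y (i + 1) t).
  have := sw_upward W (i + 1) tI; rewrite addrK !KE => H.
  by rewrite /D lerD2l lerN2.
have qn i z : q (i + n%:Z) (z + L) = q i z.
  by rewrite /q kn /wave_pot /=; congr (_ ^+ 2 / _ - _); ring.
have yS i : y i t <= y (i + 1) t by exact: (slab_le ab S i tI').
have yn' i : y (i + n%:Z) t = y i t + L by exact: yn.
have M0 : 0 <= (beta * (t - Tend))^-1 by rewrite invr_ge0 mulr_ge0// ltW.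
have [i /andP[x1 x2]] := slab_locate L0 S x tI'.
have xI : y i t < x < y (i + 1) t.
  rewrite x2 andbT lt_neqAle x1 andbT; apply/eqP => E.
  by apply: nx; rewrite -E; exists i.
have xI' : y i t <= x <= y (i + 1) t by rewrite x1 ltW.
rewrite (sw_state W tI xI) KE.
have lo := sawtooth_lower L0 M0 yS yn' mM DE qE qm Dm qn xI'.
have hi := sawtooth_upper L0 M0 yS yn' mM DE qE qm Dm qn xI'.
by rewrite -normrN opprB ler_norml lo.
Qed.

End decay.

(** The exceptional set accounts for the jumps, where u is unspecified. *)
Lemma Lnormoo_le {R : realType} (h : R -> R) (M : R) (N : set R) :
  countable N -> (forall x, ~ N x -> `|h x| <= M) -> 0 <= M ->
  (Lnorm (@lebesgue_measure R) +oo (fun x => (h x)%:E) <= M%:E)%E.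
Proof.
move=> cN hM M0; rewrite unlock; case: ifPn => _; last by rewrite lee_fin.
apply/ess_supP; exists N; split.
- exact: countable_measurable.
- exact: countable_lebesgue_measure0.
- by move=> x; apply: contra_notP => /hM /=; rewrite lee_fin.
Qed.

Lemma cvg_inv_linear {R : realType} (K beta s : R) : 0 < beta -> 0 <= K ->
  K * (beta * (t - s))^-1 @[t --> +oo] --> 0.
Proof.
move=> beta0 K0; apply/cvgrPdist_le => e e0.
near=> t.
have ts : s + (K + 1) / (beta * e) < t by near: t; apply: nbhs_pinfty_gt; exact: num_real.
have bts : K + 1 < beta * (t - s) * e.
  by move: ts; rewrite -ltrBrDl ltr_pdivrMr ?mulr_gt0// mulrA [_ * beta]mulrC.
have p0 : 0 < beta * (t - s).
  by rewrite -(pmulr_lgt0 _ e0); apply: lt_trans bts; rewrite ltr_wpDl.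
rewrite sub0r normrN ger0_norm ?mulr_ge0// ?invr_ge0 ?(ltW p0)//.
by rewrite ler_pdivrMr// mulrC; lra.
Unshelve. all: by end_near. Qed.

(** * Induction over the slabs and convergence *)

Section solution.
Variables (R : realType) (f g : R -> R) (alpha beta L u0 : R).
Variables (T X : nat -> R) (u : R -> R -> R) (theta : R -> R -> bool).
Hypothesis fg : flux_assumption f g alpha beta.
Hypothesis L0 : 0 < L.
Hypothesis u0I : 0 < u0 < alpha.
Hypothesis T1 : 0 <= T 1%N.
Hypothesis sol : spike_solution f g alpha beta L u0 T X u theta.

Lemma spike_solution_decay : exists s, forall t, s < t ->
  exists2 N, countable N &
    forall x, ~ N x -> `|u t x - u0| <= L * (beta * (t - s))^-1.
Proof.
have beta0 := fa_beta fg.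
(* [Dl] is c^2, solved from f u0 = g u0 + beta c^2 / 2; it is positive because f > g on ]0,
   alpha[. *)
pose Dl := 2 * (f u0 - g u0) / beta.
have Dl0 : 0 < Dl by rewrite divr_gt0// mulr_gt0// subr_gt0 (fa_gt fg).
pose c := Num.sqrt Dl.
have c0 : 0 < c by rewrite sqrtr_gt0.
have c2 : c ^+ 2 = Dl by rewrite sqr_sqrtr// ltW.
have cE : f u0 = g u0 + beta * c ^+ 2 / 2.
  by rewrite c2 /Dl; field; rewrite gt_eqF.
have gE := fa_g fg.
case: sol => per init [s [y [v [th]]]] /= [s0 sS soo _ slabs].
have s1 k : T 1%N <= s k.
  by elim: k => [|k]; [rewrite s0|move/le_trans; apply; exact: ltW].
have sp k : 0 <= s k by exact: le_trans T1 (s1 k).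
pose P k := if k is k'.+1 then range (y k' ^~ (s k)) else set0.
have slabP k K : wave_profile alpha beta L u0 c (T 1%N) u theta (s k) (P k) K ->
    exists Kp, slab_waves alpha beta L u0 c (T 1%N) u (s k) (s k.+1) (y k) (th k) Kp.
  move=> prof; have [fs st] := slabs k.
  have thp x : theta (s k) (x + L) = theta (s k) x by case: (per _ x (sp k)).
  have H := slab_wavesP beta0 c0 L0 gE cE (sS k) (s1 k) thp fs st prof.
  by exists (slab_wave (s k) (y k) K).
have prof k : exists K,
    wave_profile alpha beta L u0 c (T 1%N) u theta (s k) (P k) K.
  elim: k => [|k [K /slabP[Kp W]]].
    (* Just before the first insertion there is no jump and the f-interval is unbounded, which the
       alternative a <= T1 of [wp_width] allows. *)
    exists (fun=> None); split=> //=.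
    - move=> x _; rewrite s0; apply: init; rewrite T1 lexx//.
    - by left; rewrite s0.
  by have [fs _] := slabs k; exact: (next_profile L0 (sS k) fs W).
have bc : 0 < 2 * beta * c by rewrite !mulr_gt0.
exists (f_end beta L c (T 1%N)) => t tT.
have st : s 0%N < t.
  by apply: le_lt_trans tT; rewrite s0 /f_end lerDl divr_ge0 ?ltW.
have [m tm] : exists m, t <= s m.
  move/cvgryPge: soo => /(_ t) [m _ /(_ m (leqnn m)) tm].
  by exists m.
(* Open on the left and closed on the right, as [slab_waves] describes ]a, b]. *)
have [k /andP[sk tk]] : exists k, s k < t <= s k.+1.
  elim: m tm => [|m IH] tm; first by move: st; rewrite ltNge tm.
  have [tm'|tm'] := leP t (s m); first exact: IH.
  by exists m; rewrite tm' tm.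
have [K /slabP[Kp W]] := prof k.
have [fs _] := slabs k.
exists (range (y k ^~ t)).
  by apply: sub_countable (card_image_le _ _) _; exact: countableP.
move=> x nx; apply: (slab_decay beta0 c0 L0 (sS k) _ fs W _ tT nx).
  by move=> t' x' kt; have [] := per t' x' (le_trans (sp k) kt).
by rewrite sk.
Qed.

Lemma spike_solution_cvg :
  Lnorm (@lebesgue_measure R) +oo%E (fun x => (u t x - u0)%:E)
    @[t --> +oo] --> 0%E.
Proof.
have [s H] := spike_solution_decay.
have beta0 := fa_beta fg.
apply: (@squeeze_cvge _ _ _ _ (fun=> 0%E) _
  (fun t => (L * (beta * (t - s))^-1)%:E)).
- near=> t; have st : s < t by near: t; apply: nbhs_pinfty_gt; exact: num_real.
  rewrite Lnorm_ge0/=; have [N cN HN] := H t st.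
  apply: (Lnormoo_le cN HN).
  by rewrite mulr_ge0 ?(ltW L0)// invr_ge0 mulr_ge0 ?(ltW beta0)// subr_ge0 ltW.
- exact: cvg_cst.
- apply: cvg_EFin; first exact: nearW.
  exact: cvg_inv_linear (ltW L0).
Unshelve. all: by end_near. Qed.

End solution.

Theorem proposition3p1 (R : realType) (d : measure_display)
    (Omega : measurableType d) (P : probability Omega R)
    (f g : R -> R) (alpha beta lambda L u0 : R)
    (T X : nat -> {RV P >-> R})
    (u : Omega -> R -> R -> R) (theta : Omega -> R -> R -> bool)
    (fg_assumption : flux_assumption f g alpha beta)
    (lambda_gt0 : 0 < lambda) (L_gt0 : 0 < L)
    (u0_itv : 0 < u0 < alpha)
    (TX_random : random_arrivals lambda L_gt0 T X)
    (u_solution : {ae P, forall w,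
       spike_solution f g alpha beta L u0 (T ^~ w) (X ^~ w) (u w) (theta w)}) :
  {ae P, forall w,
     Lnorm (@lebesgue_measure R) +oo%E (fun x => (u w t x - u0)%:E)
       @[t --> +oo] --> 0%E}.
Proof.
(* The law of the first increment, taken at s = 0, gives probability one to T 1 > 0. *)
have T1_gt0 : {ae P, forall w, 0 < T 1%N w}.
  have mA : measurable [set w | 0 < T 1%N w].
    rewrite -[X in measurable X]setTI.
    have -> : [set w | 0 < T 1%N w] = T 1%N @^-1` `]0, +oo[.
      by apply/seteqP; split=> w /=; rewrite in_itv/= andbT.
    exact: measurable_funPT.
  have PA : P [set w | 0 < T 1%N w] = 1%E.
    have := ra_incr TX_random 0 (lexx 0); rewrite mulr0 oppr0 expR0 => <-.
    by congr (P _); apply/seteqP; split=> w /=; rewrite (ra_T0 TX_random) subr0.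
  exists (~` [set w | 0 < T 1%N w]); split; first exact: measurableC.
    by rewrite probability_setC// PA subee.
  by move=> w.
apply: filterS2 T1_gt0 u_solution => w T1 sol.
exact: (spike_solution_cvg fg_assumption L_gt0 u0_itv (ltW T1) sol).
Qed.
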